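(* Let $P=P(n,m)$ be a graph chosen uniformly at random from the class of all planar graphs on vertex set $[n]=\{1,\dots,n\}$ with $m=m(n)$ edges, and let $r=r(n)$ be a vertex of $P$ chosen uniformly at random. Suppose $m\le n/2+O(n^{2/3})$ and $2m/n\to c\in[0,1]$. Then $(P,r)$ converges in the local weak sense to $T(c)$.
   Context: A rooted graph is a pair $(H,r)$ with $r\in V(H)$; two rooted graphs are isomorphic if there is a graph isomorphism mapping root to root. For $\ell\in\mathbb N$, $B_\ell(H,r)$ is the subgraph of $H$ induced by the vertices at distance at most $\ell$ from $r$, rooted at $r$. A sequence of random rooted graphs $G_n$ converges in the local weak sense to a random rooted graph $G_0$ if for every fixed finite rooted graph $(H,r_H)$ and every $\ell\in\mathbb N$, $\Pr[B_\ell(G_n)\cong(H,r_H)]\to\Pr[B_\ell(G_0)\cong(H,r_H)]$ as $n\to\infty$. $T(c)$ denotes the Galton–Watson tree with offspring distribution Poisson$(c)$, rooted at its ancestor. *)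

(* Defs.v *)
From HB Require Import structures.
From mathcomp Require Import all_boot all_order all_algebra.
From mathcomp Require Import finmap.
From mathcomp Require Import all_classical all_reals all_analysis.
Set Implicit Arguments. Unset Strict Implicit. Unset Printing Implicit Defensive.
Import Order.TTheory GRing.Theory Num.Theory numFieldNormedType.Exports.
Local Open Scope ring_scope.

Definition is_graph (n : nat) (E : {set {set 'I_n}}) : bool :=
  [forall e in E, #|e| == 2]%N.

Definition adj (n : nat) (E : {set {set 'I_n}}) (i j : 'I_n) : bool :=
  (i != j) && ([set i; j] \in E).

Definition unit_interval (R : realType) : set R := [set t | 0 <= t <= 1].
Arguments unit_interval R : clear implicits.

Definition planar (R : realType) (n : nat) (E : {set {set 'I_n}}) : Prop :=
  exists (pos : 'I_n -> R * R) (gam : {set 'I_n} -> R -> R * R),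
    injective pos /\
    (forall e, e \in E ->
       {within unit_interval R, continuous (gam e)}%classic /\
       {in unit_interval R &, injective (gam e)} /\
       (exists u v, e = [set u; v] /\ gam e 0 = pos u /\ gam e 1 = pos v) /\
       (forall t w, 0 < t < 1 -> gam e t <> pos w)) /\
    (forall e e' s t, e \in E -> e' \in E -> e != e' ->
       unit_interval R s -> unit_interval R t -> gam e s = gam e' t ->
       (s == 0) || (s == 1)).

Definition planar_class (R : realType) (n m : nat) : {set {set {set 'I_n}}} :=
  [set E : {set {set 'I_n}} | [&& is_graph E, #|E| == m & `[< planar R E >] ]].

Fixpoint ball (n : nat) (E : {set {set 'I_n}}) (r : 'I_n) (l : nat) : {set 'I_n} :=
  match l with
  | 0 => [set r]
  | l'.+1 => ball E r l' :|: [set v | [exists u in ball E r l', adj E u v]]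
  end.

Definition ball_iso (n : nat) (E : {set {set 'I_n}}) (r : 'I_n) (l : nat)
    (k : nat) (H : {set {set 'I_k}}) (rH : 'I_k) : bool :=
  [exists f : {ffun 'I_k -> 'I_n},
    [&& injectiveb f, f @: setT == ball E r l, f rH == r &
        [forall i, forall j, adj H i j == adj E (f i) (f j)]]].

Definition pr_ball (R : realType) (n m l k : nat) (H : {set {set 'I_k}}) (rH : 'I_k) : R :=
  (#|[set p : {set {set 'I_n}} * 'I_n |
       (p.1 \in planar_class R n m) && ball_iso p.1 p.2 l H rH]|%:R)
  / ((#|planar_class R n m| * n)%N%:R).

Definition poisson_pmf (R : realType) (c : R) (j : nat) : R :=
  expR (- c) * c ^+ j / (j`!)%:R.

(* Ulam-Harris description: a finite ordered rooted tree of height <= l is a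
   finite set S of addresses (seq nat) containing the root [::], closed
   under taking parents and left siblings, with all addresses of length <= l. *)
Definition trunc_tree (l : nat) (S : {fset (seq nat)}) : Prop :=
  [::] \in S /\
  (forall u i, rcons u i \in S -> u \in S /\ (forall j, (j < i)%N -> rcons u j \in S)) /\
  (forall u, u \in S -> (size u <= l)%N).

Definition is_child (u v : seq nat) : bool :=
  (size v == (size u).+1) && (take (size u) v == u).

Definition nchildren (S : {fset (seq nat)}) (u : seq nat) : nat :=
  #|` [fset v in S | is_child u v]%fset|.

(* probability that the first l generations of T(c) form exactly the
   ordered tree S: every vertex of depth < l has Poisson(c) many children,
   independently. *)
Definition gw_weight (R : realType) (c : R) (l : nat) (S : {fset (seq nat)}) : R :=
  \prod_(u <- S | (size u < l)%N) poisson_pmf c (nchildren S u).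

Definition tree_iso (S : {fset (seq nat)}) (k : nat) (H : {set {set 'I_k}}) (rH : 'I_k) : Prop :=
  exists f : 'I_k -> seq nat,
    injective f /\ (forall i, f i \in S) /\ #|` S| = k /\ f rH = [::] /\
    (forall i j, adj H i j = is_child (f i) (f j) || is_child (f j) (f i)).

(* Pr[ B_l(T(c)) ~= (H, rH) ] : sum over the (countably many, disjoint)
   possible truncated ordered trees *)
Definition gw_ball_prob (R : realType) (c : R) (l k : nat) (H : {set {set 'I_k}}) (rH : 'I_k)
  : \bar R :=
  \esum_(S in [set S | trunc_tree l S /\ tree_iso S H rH]) (gw_weight c l S)%:E.

(* Main.v *)
(* Let T be the set of ordered pairs of vertices and draw w in T^m uniformly; every
   simple graph with m edges is the edge set of exactly m! 2^m sequences w.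

   Planarity costs only e^(-o(n)): for 2 j <= (1 - delta) n, a forest of j edges
   stays a forest after one more uniform edge with probability 1 - O(1 / n)
   (expected number of pairs joined by a path, by peeling off the first edge of
   the path), and with probability at least 1 / 16 for the remaining
   delta n + o(n) edges.  Forests are planar, so the planar graphs have
   probability at least e^(-eta n) for every eta > 0.

   Given a finite ordered tree S of height at most L, the number of roots whose
   neighbourhood explores as S changes by O(1) when one entry of w changes, and
   its mean is asymptotically n times the Galton-Watson weight of S.  By the
   exponential moment bound for functions with bounded differences and Gibbs'
   variational inequality, conditioning on an event of probability e^(-o(n))
   moves this mean by o(n) only.  Hence under the uniform planar graph every S
   has asymptotic frequency at least its Galton-Watson weight; the weights have
   total mass 1, so the lower bounds are sharp. *)
Require Import Defs.
From HB Require Import structures.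
From mathcomp Require Import all_boot all_order all_algebra.
From mathcomp Require Import finmap fingroup perm action.
From mathcomp Require Import all_classical all_reals all_analysis.
From mathcomp Require Import ring lra zify.
Import Order.TTheory GRing.Theory Num.Theory numFieldNormedType.Exports.
Set Implicit Arguments. Unset Strict Implicit. Unset Printing Implicit Defensive.

(** * Sums over tuples *)

(** Planarity destroys independence, and the number of planar graphs is never evaluated. Instead,
    conditioning on an event of probability e^(-h) lowers a mean by at most 2 s m B^2 + h / s, where
    B is the Lipschitz constant and s is free. A small constant s keeps the first term below eps n,
    and then any h = o(n) is affordable. This is why c = 1 causes no trouble: each of the last delta
    n edges may cost a constant factor, since delta is fixed after s.

    Sequences with repetition are used because their entries are independent. The upper bound for
    one ball type is the lower bound for all the other trees.

    An exploration must look one level below the ball it determines. Mass at depth l is therefore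
    first lifted to depth l + 1, by giving each vertex at depth l fewer than D children for a large
    D. *)

Lemma big_tuple_cons (T : finType) (R : Type) (idx : R)
    (op : Monoid.com_law idx) M (F : seq T -> R) :
  \big[op/idx]_(w : M.+1.-tuple T) F w =
  \big[op/idx]_(a : T) \big[op/idx]_(w : M.-tuple T) F (a :: w).
Proof.
rewrite pair_big /=.
rewrite (reindex (fun p : T * M.-tuple T => cons_tuple p.1 p.2)) //=.
exists (fun w => (thead w, behead_tuple w)) => [[a w] _|w _] /=.
  by congr pair; apply: val_inj.
by rewrite [RHS]tuple_eta; apply: val_inj.
Qed.

Lemma big_tuple_nil (T : finType) (R : Type) (idx : R)
    (op : Monoid.com_law idx) (F : seq T -> R) :
  \big[op/idx]_(w : 0.-tuple T) F w = F [::].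
Proof.
rewrite (big_pred1 [tuple]) // => w; rewrite [w]tuple0; exact/esym/eqP.
Qed.

Section Select.
Variable T : eqType.
Implicit Type w : seq T.

(** Indexed by positions rather than values, so that repeated entries are selected separately. This
    matches the distinct positions used by [conn]. *)
Fixpoint sel w : seq (T * seq T) :=
  if w is a :: w' then (a, w') :: [seq (p.1, a :: p.2) | p <- sel w'] else [::].

Lemma selP w a : a \in w ->
  exists2 w', (a, w') \in sel w & {subset w <= a :: w'}.
Proof.
elim: w => //= b w IH; rewrite inE; have [-> _|ab /= aw] := eqVneq a b.
  by exists w; rewrite ?mem_head.
have [w' sw' ww'] := IH aw; exists (b :: w').
  by rewrite inE; apply/orP; right; apply/mapP; exists (a, w').
move=> x; rewrite !inE => /predU1P[->|/ww']; first by rewrite eqxx orbT.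
by rewrite inE orbCA => ->; rewrite orbT.
Qed.

Lemma sel_subseq w p : p \in sel w -> subseq p.2 w.
Proof.
elim: w p => //= b w IH p; rewrite inE => /predU1P[->|/mapP[q /IH qw ->]] /=.
  exact: subseq_cons.
by rewrite eqxx.
Qed.

Lemma sel_size w p : p \in sel w -> size w = (size p.2).+1.
Proof.
by elim: w p => //= b w IH p; rewrite inE => /predU1P[->|/mapP[q /IH qw ->]] //=;
  rewrite qw.
Qed.

End Select.

(** Double counting: a [j]-tuple and an entry [a] arise from the [j.+1] places at which [a] can be
    inserted. *)
Lemma sum_sel (T : finType) j (h : T -> seq T -> nat) :
  \sum_(w : j.+1.-tuple T) \sum_(p <- sel w) h p.1 p.2 =
  j.+1 * \sum_(a : T) \sum_(w : j.-tuple T) h a w.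
Proof.
elim: j h => [|j IH] h.
  rewrite (@big_tuple_cons _ _ _ _ _ (fun w => \sum_(p <- sel w) h p.1 p.2)) mul1n.
  apply: eq_bigr => a _.
  rewrite (@big_tuple_nil _ _ _ _ (fun w => \sum_(p <- sel (a :: w)) h p.1 p.2)).
  by rewrite /= big_seq1 (@big_tuple_nil _ _ _ _ (h a)).
rewrite (@big_tuple_cons _ _ _ _ _ (fun w => \sum_(p <- sel w) h p.1 p.2)).
under eq_bigr => a _.
  under eq_bigr => w _ do rewrite /= big_cons big_map /=.
  rewrite big_split /= (IH (fun b w => h b (a :: w))).
over.
rewrite big_split /= -big_distrr /= [in RHS]mulSn; congr addn; congr muln.
rewrite exchange_big /=; apply: eq_bigr => a _.
by rewrite (@big_tuple_cons _ _ _ _ _ (h a)).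
Qed.

(** * Forest sequences *)

Section Forest.
Variable V : finType.
Implicit Types (w : seq (V * V)) (u v x y : V).

Definition adjw w : rel V := fun x y => ((x, y) \in w) || ((y, x) \in w).

Lemma adjw_sym w x y : adjw w x y = adjw w y x.
Proof. exact: orbC. Qed.

Lemma adjw_sub w w' : {subset w <= w'} -> subrel (adjw w) (adjw w').
Proof. by move=> ww' x y /orP[] /ww' h; rewrite /adjw h ?orbT. Qed.

Lemma connw_sym w : connect_sym (adjw w).
Proof. by apply/sym_connect_sym => x y; exact: adjw_sym. Qed.

Lemma connw_sub w w' x y : {subset w <= w'} ->
  connect (adjw w) x y -> connect (adjw w') x y.
Proof.
move=> ww'; apply: connect_sub => {}x {}y /(adjw_sub ww'); exact: connect1.
Qed.

(** Arcs are added from the tail. Since [connect] is reflexive and contains the arcs already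
    present, loops and repeated edges are rejected along with longer cycles. *)
Fixpoint forest w :=
  if w is a :: w' then ~~ connect (adjw w') a.1 a.2 && forest w' else true.

Lemma forest_subseq w w' : subseq w' w -> forest w -> forest w'.
Proof.
elim: w w' => [|a w IH] [|b w'] //=; case: eqP => [->|_] sw /andP[aw fw].
  rewrite (IH _ sw fw) andbT; apply: contra aw.
  by apply: connw_sub; exact: mem_subseq.
by apply: (IH (b :: w')).
Qed.

(* u and v are joined by a walk using k distinct positions of w. *)
Fixpoint conn k w u v : bool :=
  if k is k'.+1 then
    has (fun p => [exists x, ((p.1 == (u, x)) || (p.1 == (x, u)))
                             && conn k' p.2 x v]) (sel w)
  else u == v.

Lemma conn_size k w u v : conn k w u v -> (k <= size w)%N.
Proof.
elim: k w u => //= k IH w u /hasP[p /sel_size -> /existsP[x /andP[_ /IH]]].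
by [].
Qed.

Lemma path_conn w x p : path (adjw w) x p -> uniq (x :: p) ->
  conn (size p) w x (last x p).
Proof.
elim: p x w => [|y p IH] x w; first by rewrite /= eqxx.
move=> /andP[xy yp] /andP[xnotin up].
have [a aw aE] : exists2 a, a \in w & (a == (x, y)) || (a == (y, x)).
  by case/orP: xy => h; [exists (x, y)|exists (y, x)]; rewrite ?eqxx ?orbT.
have [w' sw' ww'] := selP aw.
apply/hasP; exists (a, w') => //=; apply/existsP; exists y; rewrite aE /=.
apply: IH => //.
(* Only the arc [a], incident to [x], may be missing from [w'], and the rest of a simple path never
   returns to [x]. *)
have sub : {in [pred z | z != x] &, subrel (adjw w) (adjw w')}.
  move=> z t; rewrite !inE => zx tx /orP[] /ww'; rewrite inE => /predU1P[h|h].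
  - by case/orP: aE => /eqP E; move: h; rewrite E => -[e1 e2];
      rewrite ?e1 ?e2 eqxx in zx tx.
  - by rewrite /adjw h.
  - by case/orP: aE => /eqP E; move: h; rewrite E => -[e1 e2];
      rewrite ?e1 ?e2 eqxx in zx tx.
  - by rewrite /adjw h orbT.
apply: (sub_in_path sub) yp.
by apply/allP => z zp; rewrite inE; apply: contraNneq xnotin => <-.
Qed.

Lemma connect_conn w u v : connect (adjw w) u v ->
  exists2 k, (k <= size w)%N & conn k w u v.
Proof.
case/connectP=> p pth ->; case/shortenP: pth => p' pth' up' _.
by exists (size p'); [exact: conn_size (path_conn pth' up')|exact: path_conn].
Qed.

Definition nforest j := \sum_(w : j.-tuple (V * V)) forest w.
Definition npath j k := \sum_(w : j.-tuple (V * V)) forest w * \sum_u \sum_v conn k w u v.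

Lemma npath0 j : npath j 0 = #|V| * nforest j.
Proof.
rewrite /npath /nforest big_distrr /=; apply: eq_bigr => w _; rewrite mulnC.
congr (_ * _); rewrite -sum1_card; apply: eq_bigr => u _.
by rewrite (bigD1 u) //= eqxx big1 ?addn0 // => v /negbTE vu; rewrite eq_sym vu.
Qed.

(* Peel off the first edge {u, x} of the path; it is recovered from its
   position in w, the vertex u and an orientation. *)
Lemma npathS j k : npath j.+1 k.+1 <= 2 * j.+1 * #|V| * npath j k.
Proof.
pose h (a : V * V) (w : seq (V * V)) := forest w *
  \sum_x \sum_v (conn k w x v * \sum_u ((a == (u, x)) + (a == (x, u)))).
apply: (@leq_trans (\sum_(w : j.+1.-tuple (V * V)) \sum_(p <- sel w) h p.1 p.2)).
  apply: leq_sum => w _; case fw : (forest w) => //; rewrite mul1n.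
  apply: (@leq_trans (\sum_(p <- sel w) \sum_x \sum_v
     (conn k p.2 x v * \sum_u ((p.1 == (u, x)) + (p.1 == (x, u)))))); last first.
    rewrite big_seq [leqRHS]big_seq; apply: leq_sum => p pw.
    by rewrite /h (forest_subseq (sel_subseq pw) fw) mul1n.
  under [leqRHS]eq_bigr => p _.
    rewrite exchange_big /=.
    under eq_bigr => v _ do (under eq_bigr => x _ do rewrite big_distrr /=).
  over.
  rewrite exchange_big [leqRHS]exchange_big /=; apply: leq_sum => v _.
  under [leqRHS]eq_bigr => p _ do rewrite exchange_big /=.
  rewrite [leqRHS]exchange_big /=; apply: leq_sum => u _.
  case: hasP => // -[p pw /existsP[x /andP[px cx]]].
  rewrite (big_rem p) //= (bigD1 x) //= cx mul1n.
  by case/orP: px => ->; rewrite ?addnA ?addn1 // -!addnA addnCA.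
rewrite sum_sel (mulnC 2) -!mulnA leq_mul2l mulnA /= /npath big_distrr /=.
rewrite exchange_big /=; apply: leq_sum => w _.
rewrite /h -big_distrr /= mulnCA leq_mul2l; apply/orP; right.
rewrite big_distrr exchange_big /=; apply: leq_sum => x _.
rewrite big_distrr exchange_big /=; apply: leq_sum => v _.
rewrite -big_distrr /= mulnC leq_mul2r exchange_big /=; apply/orP; right.
rewrite (eq_bigr (fun _ => 2)) ?sum_nat_const 1?mulnC // => u _.
have E (b : V * V) : \sum_i (i == b : nat) = 1.
  by rewrite (bigD1 b) //= eqxx big1 // => i /negbTE ->.
by rewrite big_split /= !E.
Qed.
End Forest.

(** * Growth of the number of forests when one edge is added *)

Section ForestCount.
Variable V : finType.
Implicit Types (w : seq (V * V)) (u v x y : V).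
Local Notation n := #|V|.
Local Notation F := (nforest V).

Lemma npath_le j k : (k <= j)%N ->
  (npath V j k <= n * (2 * n * j) ^ k * F (j - k))%N.
Proof.
elim: k j => [|k IH] j kj; first by rewrite npath0 expn0 muln1 subn0.
case: j kj => // j; rewrite ltnS => kj.
apply: leq_trans (npathS _ _ _) _; rewrite subSS.
apply: leq_trans (leq_mul (leqnn _) (IH _ kj)) _.
rewrite !mulnA leq_mul2r; apply/orP; right.
rewrite expnSr [leqLHS](_ : _ = n * (2 * n * j) ^ k * (2 * n * j.+1))%N; last by ring.
rewrite [leqRHS]mulnA leq_mul2r leq_mul2l; apply/orP; right; apply/orP; right.
by case: (k) => // i; rewrite leq_exp2r // leq_mul2l leqnSn orbT.
Qed.

(** A prepended arc either joins two components or has connected ends; loops belong to the second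
    kind by reflexivity. *)
Lemma nforestS j :
  (F j.+1 + \sum_(w : j.-tuple (V * V)) forest w * \sum_u \sum_v connect (adjw w) u v
   = n ^ 2 * F j)%N.
Proof.
rewrite /F (@big_tuple_cons _ _ _ _ _ (fun w => nat_of_bool (forest w))) exchange_big.
rewrite -big_split /= big_distrr /=; apply: eq_bigr => w _.
have [fw|_] := boolP (forest w); last first.
  by rewrite muln0 mul0n addn0 big1 // => a _; rewrite andbF.
rewrite mul1n muln1 pair_big -big_split /= -mulnn -card_prod -sum1_card.
by apply: eq_bigr => a _; rewrite andbT; case: connect.
Qed.

(** Union bound over the length [k] of a path joining the two ends, each length being estimated by
    [npath_le]. *)
Lemma nforestS_ge j :
  (n ^ 2 * F j <= F j.+1 + \sum_(k < j.+1) n * (2 * n * j) ^ k * F (j - k))%N.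
Proof.
rewrite -nforestS leq_add2l.
apply: (@leq_trans (\sum_(k < j.+1) npath V j k)); last first.
  by apply: leq_sum => k _; apply: npath_le; rewrite -ltnS.
rewrite /npath exchange_big; apply: leq_sum => w _ /=.
rewrite -big_distrr /= leq_mul2l; apply/orP; right.
rewrite [leqRHS]exchange_big; apply: leq_sum => u _ /=.
rewrite [leqRHS]exchange_big; apply: leq_sum => v _ /=.
case cuv : (connect _ _ _) => //; have [k kj ck] := connect_conn cuv.
rewrite size_tuple -ltnS in kj.
by rewrite (bigD1 (Ordinal kj)) //= ck.
Qed.

Lemma connect_cons w a u v : connect (adjw (a :: w)) u v ->
  [|| connect (adjw w) u v, connect (adjw w) a.1 v | connect (adjw w) a.2 v].
Proof.
pose Q := [pred z | [|| connect (adjw w) u z, connect (adjw w) a.1 z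
                      | connect (adjw w) a.2 z]].
suff cl : forall x y, adjw (a :: w) x y -> Q x -> Q y.
  have gen p z : path (adjw (a :: w)) z p -> Q z -> Q (last z p).
    elim: p z => //= y p IH z /andP[zy yp] Qz; exact: IH yp (cl _ _ zy Qz).
  by case/connectP => p pth ->; apply: (gen _ _ pth); rewrite /= connect0.
move=> x y; rewrite /adjw !inE.
have [e1|n1] := eqVneq (x, y) a; first by move=> _ _; rewrite /= -e1 /= connect0 !orbT.
have [e2|n2] := eqVneq (y, x) a; first by move=> _ _; rewrite /= -e2 /= connect0 !orbT.
move=> /= h; have xy : connect (adjw w) x y by apply: connect1.
by move=> /or3P[] /connect_trans /(_ xy) ->; rewrite ?orbT.
Qed.

(** One representative per component: a new arc merges at most two components, and it suffices to
    drop the representative connected to [a.2], if there is one. *)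
Lemma independent_reps w : exists2 T : {set V}, (n <= #|T| + size w)%N &
  {in T &, forall x y, connect (adjw w) x y -> x = y}.
Proof.
elim: w => [|a w [T Tn TP]].
  exists [set: V]; first by rewrite cardsT addn0.
  by move=> x y _ _ /connectP[[|z p] //= /andP[]].
pose A := T :&: [set t | connect (adjw w) t a.2].
exists (T :\: A).
  have : (#|A| <= 1)%N.
    apply/card_le1_eqP => x y; rewrite !inE => /andP[xT xa] /andP[yT ya].
    apply: TP => //. by apply: (connect_trans ya); rewrite connw_sym.
  rewrite /= cardsD (finset.setIidPr (subsetIl _ _)) -/A.
  move: #|A| Tn; move: #|T| #|V| => i j k; lia.
move=> x y; rewrite !inE => /andP[+ xT] /andP[+ yT].
rewrite xT yT /= => xa ya xy; apply: TP => //.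
move: (connect_cons xy); rewrite connw_sym in xy.
move: (connect_cons xy); rewrite ![connect _ a.2 _]connw_sym (negbTE xa) (negbTE ya).
rewrite !orbF => /orP[yx _|ax /orP[//|ay]]; first by rewrite connw_sym.
by apply: connect_trans ay; rewrite connw_sym.
Qed.

(** At least t >= n/3 representatives remain, and any ordered pair of distinct ones is an admissible
    new arc. From n >= 7 follows t >= 3, and then n^2 <= 9 t^2 <= 16 t (t - 1). *)
Lemma nforestS_ge16 j : (7 <= n)%N -> (3 * j <= 2 * n)%N ->
  (n ^ 2 * F j <= 16 * F j.+1)%N.
Proof.
move=> n7 jn; rewrite /F (@big_tuple_cons _ _ _ _ _ (fun w => nat_of_bool (forest w))).
rewrite exchange_big !big_distrr; apply: leq_sum => w _ /=.
have [fw|_] := boolP (forest w); last by rewrite muln0.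
have [T Tn TP] := independent_reps w; rewrite size_tuple in Tn.
have -> : \sum_(i : V * V) (~~ connect (adjw w) i.1 i.2 && true) =
          #|[set i : V * V | ~~ connect (adjw w) i.1 i.2]|.
  by rewrite -sum1dep_card [RHS]big_mkcond; apply: eq_bigr => a _; rewrite andbT; case: connect.
rewrite muln1.
apply: (@leq_trans (16 * #|(finset.setX T T) :\: [set (t, t) | t in T]|)).
  rewrite cardsD cardsX (finset.setIidPr _); last first.
    by apply/fintype.subsetP => x /imsetP[t tT ->]; rewrite inE tT.
  rewrite card_imset; last by move=> x y [].
  move: n7 jn Tn; move: #|T| #|V| => t k k7 jk kt.
  have kt3 : k <= 3 * t by lia.
  have -> : t * t - t = t * t.-1 by rewrite -subn1 mulnBr muln1.
  rewrite -mulnn; apply: (leq_trans (leq_mul kt3 kt3)).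
  have t3 : 3 <= t by lia.
  by case: t t3 {kt kt3} => [|[|[|s]]] //= _; lia.
rewrite leq_mul2l; apply/orP; right; apply/subset_leq_card/fintype.subsetP => -[x y].
rewrite !inE /= => /andP[+ /andP[xT yT]]; apply: contra => /(TP _ _ xT yT) <-.
by apply/imsetP; exists x.
Qed.

Section Real.
Local Open Scope ring_scope.
Variable R : realType.
Variables (delta : R).
Hypothesis d01 : 0 < delta < 1.
(** [theta] / n bounds the probability that a new edge closes a cycle. It comes from the geometric
    series of ratio [rho] over path lengths, whose sum is at most 1 / (1 - [rho]) = 2 / [delta]. *)
Let theta := 2 / delta.
Let rho := 1 - delta / 2.
Let nR : R := n%:R.
Let q := (1 - theta / nR) * nR ^+ 2.

(* The bound at j follows from the same bound at all i < j, which controls the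
   ratios nforest (j - k) / nforest j in [nforestS_ge]. *)
Lemma nforest_subcritical j : 4 / delta ^+ 2 <= nR -> 2 * j%:R <= (1 - delta) * nR ->
  q * (F j)%:R <= (F j.+1)%:R :> R.
Proof.
move=> nbig; case/andP: d01 => d0 d1.
have n0 : 0 < nR by apply: lt_le_trans nbig; rewrite divr_gt0 // exprn_gt0.
have tn : theta / nR <= delta / 2.
  rewrite ler_pdivrMr // /theta.
  have -> : 2 / delta = delta / 2 * (4 / delta ^+ 2) by field; rewrite gt_eqF.
  by rewrite ler_pM2l // divr_gt0.
have q0 : 0 <= q by rewrite mulr_ge0 ?sqr_ge0 //; lra.
have rho0 : 0 <= rho by rewrite /rho; lra.
elim/ltn_ind: j => j IH jn.
have Hk k : (k <= j)%N -> q ^+ k * (F (j - k))%:R <= (F j)%:R :> R.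
  elim: k => [|k IHk] kj; first by rewrite expr0 mul1r subn0.
  apply: le_trans (IHk (ltnW kj)); rewrite exprSr -mulrA ler_wpM2l ?exprn_ge0 //.
  have -> : (j - k = (j - k.+1).+1)%N by rewrite subnSK.
  apply: IH; first by rewrite ltn_subrL /=; case: (j) kj.
  by apply: le_trans jn; rewrite ler_wpM2l // ler_nat leq_subr.
(* Uses rho^2 >= 1 - delta, and 1 - theta / n >= rho from the size condition on n. So the factor 2 n
   j paid for each path edge is at most rho times the factor q recovered by [Hk]. *)
have jq : 2 * nR * j%:R <= rho * q.
  rewrite [leLHS](_ : _ = nR * (2 * j%:R)); last by ring.
  apply: (@le_trans _ _ (nR * ((1 - delta) * nR))); first by rewrite ler_wpM2l // ltW.
  rewrite /q [leRHS](_ : _ = nR * ((rho * (1 - theta / nR)) * nR)); last by ring.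
  rewrite ler_pM2l // ler_pM2r //.
  apply: (@le_trans _ _ (rho * rho)); first by rewrite /rho; nra.
  by rewrite ler_wpM2l // /rho; lra.
have := nforestS_ge j; rewrite -(ler_nat R) natrD natrM natrX -/nR => H.
have sumle : (\sum_(k < j.+1) n * (2 * n * j) ^ k * F (j - k))%N%:R <= nR * theta * (F j)%:R.
  rewrite natr_sum.
  apply: (@le_trans _ _ (\sum_(k < j.+1) nR * rho ^+ k * (F j)%:R)).
    apply: ler_sum => k _; rewrite !natrM natrX !natrM -/nR -!mulrA ler_pM2l //.
    have kj : (k <= j)%N by rewrite -ltnS.
    apply: le_trans (ler_wpM2l (exprn_ge0 k rho0) (Hk k kj)).
    rewrite [leRHS]mulrA ler_wpM2r // -exprMn mulrA.
    by apply: lerXn2r => //; rewrite nnegrE mulr_ge0 // mulr_ge0 ?ltW.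
  rewrite -mulr_suml ler_wpM2r // -mulr_sumr ler_pM2l //.
  have E := subrX1 rho j.+1.
  have : (delta / 2) * \sum_(i < j.+1) rho ^+ i <= 1.
    rewrite (_ : delta / 2 = - (rho - 1)) ?mulNr -?E ?opprB ?lerBlDr ?lerDl ?exprn_ge0 //.
    by rewrite /rho; ring.
  by rewrite mulrAC ler_pdivrMr // mul1r mulrC /theta ler_pdivlMr.
have qE : q * (F j)%:R = nR ^+ 2 * (F j)%:R - nR * theta * (F j)%:R.
  by rewrite /q; field; rewrite gt_eqF.
by rewrite qE lerBlDr; apply: le_trans H _; rewrite lerD2l.
Qed.
End Real.
End ForestCount.

(** * Exponential lower bound for the number of forests *)

Section ForestLower.
Local Open Scope ring_scope.
Variable R : realType.

Lemma expRN2_le (x : R) : 0 <= x <= 1 / 2 -> expR (- (2 * x)) <= 1 - x.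
Proof.
move=> /andP[x0 x1]; rewrite expRN -div1r ler_pdivrMr ?expR_gt0 //.
apply: (@le_trans _ _ ((1 - x) * (1 + 2 * x))); first by nra.
by rewrite ler_wpM2l ?expR_ge1Dx // subr_ge0; lra.
Qed.

Lemma expRN4_le : expR (- 4) <= 1 / 16 :> R.
Proof.
rewrite expRN -div1r ler_pdivrMr ?expR_gt0 // mulrAC ler_pdivlMr // !mul1r.
have -> : 4 = 4%:R * 1 :> R by rewrite mulr1.
rewrite expRM_natl; apply: (@le_trans _ _ (2 ^+ 4)); first by rewrite -natrX.
by apply: lerXn2r; rewrite ?nnegrE ?expR_ge0 //; have := @expR_ge1Dx R 1; lra.
Qed.

(** The three losses: at most n factors 1 - (2 / delta) / n cost e^(-4 / delta), and the at most
    delta n + 1 edges beyond (1 - delta) n / 2 cost 1/16 >= e^(-4) each. *)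
Lemma nforest_ge (V : finType) (delta : R) m :
  0 < delta <= 1 / 3 -> 7 <= #|V|%:R :> R -> 4 / delta ^+ 2 <= #|V|%:R ->
  2 * m%:R <= (1 + delta) * #|V|%:R ->
  expR (- (4 * delta * #|V|%:R + 4 / delta + 4)) * #|V|%:R ^+ (2 * m)
    <= (nforest V m)%:R.
Proof.
move=> /andP[d0 d3] n7 nd; set n : R := #|V|%:R.
have n0 : 0 < n by rewrite /n; lra.
have dn : delta * n <= 1 / 3 * n by rewrite ler_wpM2r // ltW.
have tn : 2 / delta / n <= 1 / 2.
  rewrite ler_pdivrMr //; apply: (@le_trans _ _ (1 / 2 * (4 / delta ^+ 2))).
    have -> : 1 / 2 * (4 / delta ^+ 2) = 2 / delta / delta by field; rewrite gt_eqF.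
    rewrite ler_pdivlMr // ler_piMr ?divr_ge0 ?(ltW d0) //; lra.
  by rewrite ler_pM2l.
set x := 1 - 2 / delta / n.
have t0 : 0 <= 2 / delta / n by rewrite !divr_ge0 // ltW.
have [x0 x1] : 0 <= x /\ x <= 1 by rewrite /x; lra.
pose J := Num.truncn ((1 - delta) * n / 2).
have J0 : 0 <= (1 - delta) * n / 2 by rewrite divr_ge0 // mulr_ge0 ?ltW //; lra.
have /andP[J1 J2] : J%:R <= (1 - delta) * n / 2 < J.+1%:R by apply: truncn_itv.
(* Truncated subtraction makes the exponent of 1/16 zero up to [J], so one formula covers both
   regimes. *)
have main i : 2 * i%:R <= (1 + delta) * n ->
    x ^+ i * (1 / 16) ^+ (i - J)%N * n ^+ (2 * i) <= (nforest V i)%:R.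
  elim: i => [|i IH] im.
    by rewrite sub0n !expr0 !mulr1 ler1n /nforest
      (@big_tuple_nil _ _ _ _ (fun w => nat_of_bool (forest w))).
  have im' : 2 * i%:R <= (1 + delta) * n.
    by apply: le_trans im; rewrite ler_wpM2l // ler_nat.
  move: (IH im') => {}IH; rewrite mulnS exprD.
  have [iJ|Ji] := ltnP i J.
    have iJ' := iJ; rewrite -subn_eq0 in iJ'; rewrite (eqP iJ') expr0 mulr1.
    move: IH; rewrite (eqP (_ : (i - J == 0)%N)) ?subn_eq0 ?(ltnW iJ) // expr0 mulr1 => IH.
    apply: le_trans (nforest_subcritical (delta := delta) _ nd _); first last.
    - apply: le_trans (_ : 2 * J%:R <= _); last by lra.
      by rewrite ler_wpM2l // ler_nat ltnW.
    - by apply/andP; split=> //; lra.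
    rewrite -/n -/x exprS -!mulrA ler_wpM2l //.
    by rewrite mulrCA ler_pM2l // mulrCA ler_pM2l.
  rewrite subSn // !(exprS _ i) (exprS _ (i - J)) -/n.
  apply: (@le_trans _ _ (1 / 16 * (n ^+ 2 * (nforest V i)%:R))).
    rewrite [leLHS](_ : _ = 1 / 16 * (n ^+ 2 *
        (x * (x ^+ i * (1 / 16) ^+ (i - J) * n ^+ (2 * i))))).
      rewrite ler_pM2l // ler_pM2l ?exprn_gt0 //.
      by apply: le_trans IH; rewrite ler_piMl // !mulr_ge0 ?exprn_ge0 // ltW.
    by ring.
  rewrite mul1r ler_pdivrMl // -natrX -!natrM ler_nat.
  apply: nforestS_ge16; first by rewrite -(ler_nat R).
  by rewrite -(ler_nat R) !natrM -/n; lra.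
move=> mn; apply: le_trans (main _ mn); rewrite ler_wpM2r ?exprn_ge0 ?(ltW n0) //.
have m1 : m%:R <= n by lra.
have E1 : expR (- (4 / delta)) <= x ^+ m.
  apply: (@le_trans _ _ (expR (- (2 * (2 / delta / n))) ^+ m)); last first.
    by apply: lerXn2r; rewrite ?nnegrE ?expR_ge0 // /x expRN2_le // t0.
  rewrite -expRM_natl ler_expR mulrN lerN2.
  have -> : 4 / delta = n * (2 * (2 / delta / n)) by field; rewrite !gt_eqF.
  by rewrite ler_wpM2r // mulr_ge0.
have E2 : expR (- (4 * delta * n + 4)) <= (1 / 16) ^+ (m - J)%N.
  apply: (@le_trans _ _ (expR (- 4) ^+ (m - J)%N)); last first.
    by apply: lerXn2r; rewrite ?nnegrE ?expR_ge0 // expRN4_le.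
  rewrite -expRM_natl ler_expR mulrN lerN2.
  have : (m - J)%N%:R <= delta * n + 1.
    have [mJ|/ltnW Jm] := leqP m J.
      by move/eqP: mJ => ->; rewrite addr_ge0 ?mulr_ge0 ?ltW.
    by rewrite natrB //; move: J2 mn; rewrite -[J.+1%:R]natr1; lra.
  lra.
have -> : - (4 * delta * n + 4 / delta + 4) = - (4 / delta) + - (4 * delta * n + 4) by ring.
by rewrite expRD; apply: ler_pM => //; exact: expR_ge0.
Qed.
End ForestLower.

(** * Forests are planar *)

Section ForestLayout.
Variable V : finType.
Implicit Types (w : seq (V * V)) (u v x y z : V) (S : {set V}).

Lemma forest_irrefl w x : forest w -> ~~ adjw w x x.
Proof.
elim: w => //= a w IH /andP[aw /IH]; apply: contra; rewrite /adjw !orbb inE.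
by case/predU1P => // ax; rewrite -ax connect0 in aw.
Qed.

(** Isolated vertices count as leaves, so that sets meeting several components need no separate
    treatment. *)
Definition leaf w S z := (z \in S) && (#|[set y in S | adjw w z y]| <= 1)%N.

(** Among the vertices of [S'], the new edge [r r'] changes the degree of [r] only, and one of the
    two leaves supplied for [S'] differs from [r]. If [S'] is just [r], its only possible neighbour
    is [r']. *)
Lemma leaf_branch w r r' S S' : forest w ->
  (forall S, (1 < #|S|)%N -> exists z z', [/\ z != z', leaf w S z & leaf w S z']) ->
  S' \subset S -> r \in S' -> r' \notin S' ->
  (forall z y, z \in S' -> y \in S -> adjw w z y -> y \in S') ->
  forall w', (forall z y, adjw w' z y =
     [|| adjw w z y, (z == r) && (y == r') | (z == r') && (y == r)]) ->
  exists2 z, z \in S' & leaf w' S z.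
Proof.
move=> fw IH /fintype.subsetP S'S rS' r'S' cl w' w'E.
have [S'1|S'1] := leqP #|S'| 1.
  exists r => //; rewrite /leaf S'S //=; apply/card_le1_eqP => y y'.
  have eqr z : z \in S' -> z = r by move/card_le1_eqP: S'1 => h zS'; exact: h.
  have H z : z \in [set y in S | adjw w' r y] -> z = r'.
    rewrite inE w'E => /andP[zS /or3P[az|/andP[_ /eqP//]|/andP[/eqP rr']]].
      by have := cl _ _ rS' zS az => /eqr zr; move: az;
         rewrite zr (negbTE (forest_irrefl _ fw)).
    by rewrite rr' (negbTE r'S') in rS'.
  by move=> /H -> /H ->.
have [z [z' [zz' lz lz']]] := IH _ S'1.
have [t [tr /andP[tS' Nt]]] : exists t, t != r /\ leaf w S' t.
  have [zr|zr] := eqVneq z r; last by exists z.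
  by exists z'; split => //; rewrite -zr eq_sym.
exists t => //; rewrite /leaf S'S //=; apply: leq_trans Nt.
apply/subset_leq_card/fintype.subsetP => y; rewrite !inE w'E (negbTE tr) /=.
have -> : (t == r') = false by apply: contraNF r'S' => /eqP <-.
by rewrite orbF => /andP[yS ty]; rewrite ty (cl _ _ tS' yS ty).
Qed.

(** Two leaves are claimed where one would do later, because the induction can lose one of them at
    the end of the new edge. *)
Lemma forest_leaves w S : forest w -> (1 < #|S|)%N ->
  exists z z', [/\ z != z', leaf w S z & leaf w S z'].
Proof.
elim: w S => [|[p q] w IH] S /=.
  move=> _ /card_gt1P[x [y [xS yS xy]]]; exists x, y.
  have N0 z : [set y in S | adjw [::] z y] = finset.set0.
    by apply/setP => t; rewrite !inE andbF.
  by rewrite /leaf !N0 cards0 xS yS.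
move=> /andP[pq fw] S1.
have aE z y : adjw ((p, q) :: w) z y =
    [|| adjw w z y, (z == p) && (y == q) | (z == q) && (y == p)].
  by rewrite /adjw !inE !xpair_eqE (andbC (y == p)) orbACA orbC.
have {}IH S0 := IH S0 fw.
have [pS|pS] := boolP (p \in S); last first.
  have [z [z' [zz' /andP[zS lz] /andP[z'S lz']]]] := IH _ S1; exists z, z'.
  have NE t : t \in S -> [set y in S | adjw ((p, q) :: w) t y] = [set y in S | adjw w t y].
    move=> tS; apply/setP => y; rewrite !inE aE; have [yS|//] := boolP (y \in S).
    have -> : (t == p) = false by apply: contraNF pS => /eqP <-.
    have -> : (y == p) = false by apply: contraNF pS => /eqP <-.
    by rewrite andbF !orbF.
  by rewrite /leaf !NE // zS z'S lz lz'.
have [qS|qS] := boolP (q \in S); last first.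
  have [z [z' [zz' /andP[zS lz] /andP[z'S lz']]]] := IH _ S1; exists z, z'.
  have NE t : t \in S -> [set y in S | adjw ((p, q) :: w) t y] = [set y in S | adjw w t y].
    move=> tS; apply/setP => y; rewrite !inE aE; have [yS|//] := boolP (y \in S).
    have -> : (t == q) = false by apply: contraNF qS => /eqP <-.
    have -> : (y == q) = false by apply: contraNF qS => /eqP <-.
    by rewrite andbF !orbF.
  by rewrite /leaf !NE // zS z'S lz lz'.
(* The new edge is the only one leaving the component [C] of [p], so each side of this cut supplies
   a leaf. *)
pose C := [set y | connect (adjw w) p y].
have clC z y : adjw w z y -> (z \in C) = (y \in C).
  move=> zy; rewrite !inE; apply/idP/idP => h; apply: (connect_trans h);
    by apply: connect1 => //; rewrite adjw_sym.
have [z zC lz] : exists2 z, z \in S :&: C & leaf ((p, q) :: w) S z.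
  apply: (@leaf_branch w p q) => //.
  - exact: subsetIl.
  - by rewrite !inE pS connect0.
  - by rewrite !inE qS (negbTE pq).
  - by move=> z y; rewrite inE => /andP[_ zC] yS zy; rewrite inE yS -(clC _ _ zy).
have [z' z'C lz'] : exists2 z, z \in S :\: C & leaf ((p, q) :: w) S z.
  apply: (@leaf_branch w q p) => //.
  - exact: subsetDl.
  - by rewrite inE [q \in C]inE (negbTE pq).
  - by rewrite !inE connect0.
  - by move=> z' y; rewrite inE => /andP[z'nC _] yS zy; rewrite inE yS andbT -(clC _ _ zy).
  - by move=> t y; rewrite aE; congr orb; rewrite orbC.
exists z, z'; split=> //; apply: contraTneq zC => ->.
by rewrite inE negb_and; move: z'C; rewrite inE => /andP[-> _]; rewrite orbT.
Qed.

(** Remove a leaf, lay out the rest, and reinsert the leaf next to its only neighbour, where its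
    edge spans no other vertex and so cannot be crossed. *)
Lemma forest_layout w S : forest w -> exists pos : V -> nat,
  {in S &, injective pos} /\
  forall a b c d, a \in S -> b \in S -> c \in S -> d \in S ->
    adjw w a b -> adjw w c d -> ~ (pos a < pos c < pos b /\ pos b < pos d)%N.
Proof.
move=> fw; elim: {S}#|S| {-2}S (leqnn #|S|) => [|s IH] S sS.
  exists (fun=> 0%N); split; last by move=> a b c d _ _ _ _ _ _ [].
  by move=> x y xS; move: sS; rewrite leqn0 cards_eq0 => /eqP S0; rewrite S0 inE in xS.
have [S1|S1] := leqP #|S| 1.
  exists (fun=> 0%N); split; last by move=> a b c d _ _ _ _ _ _ [].
  by move=> x y xS yS _; move/card_le1_eqP: S1; exact.
have [z [_ [_ /andP[zS /card_le1_eqP lz] _]]] := forest_leaves fw S1.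
have [|pos [posI posX]] := IH (S :\ z).
  by move: sS; rewrite (cardsD1 z S) zS.
(* For an isolated [z] the default [u = z] is harmless: [z] then gets some odd position, while all
   other positions are even. *)
pose u := odflt z [pick y | (y \in S) && adjw w z y].
have uE y : y \in S -> adjw w z y -> y = u.
  move=> yS zy; rewrite /u; case: pickP => [t /andP[tS zt]|/(_ y)]; last by rewrite yS zy.
  by apply: lz; rewrite inE ?yS ?tS.
have nbr y : y \in S -> adjw w z y -> y != z /\ y = u.
  move=> yS zy; split; last exact: uE.
  by apply: contraTneq zy => ->; exact: forest_irrefl.
have nbr' y : y \in S -> adjw w y z -> y != z /\ y = u by rewrite adjw_sym; exact: nbr.
(* The leaf z is placed immediately to the right of its neighbour u. *)
pose pos' x := if x == z then (2 * pos u).+1 else 2 * pos x.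
exists pos'; split.
  move=> x y xS yS; rewrite /pos'; have [->|xz] := eqVneq x z; have [->|yz] := eqVneq y z => //.
  - by move=> E; exfalso; clear -E; lia.
  - by move=> E; exfalso; clear -E; lia.
  - by move=> E; apply: posI; rewrite ?inE ?xz ?yz //; clear -E; lia.
move=> a b c d aS bS cS dS ab cd; rewrite /pos'.
have [az|az] := eqVneq a z.
  rewrite az in ab; have [bz bu] := nbr _ bS ab; rewrite bu in bz *; rewrite (negbTE bz).
  by case: ifP => _ [h _]; clear -h; lia.
have [bz|bz] := eqVneq b z.
  rewrite bz in ab; have [_ bu] := nbr' _ aS ab; rewrite -bu.
  by case: ifP => _ [h _]; clear -h; lia.
have [cz|cz] := eqVneq c z.
  rewrite cz in cd; have [dz du] := nbr _ dS cd; rewrite -du (negbTE dz).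
  by move=> [h1 h2]; clear -h1 h2; lia.
have [dz|dz] := eqVneq d z.
  rewrite dz in cd; have [_ cu] := nbr' _ cS cd; rewrite -cu.
  by move=> [h1 h2]; clear -h1 h2; lia.
move=> h; apply: (posX a b c d); rewrite ?inE ?az ?bz ?cz ?dz //.
by move: h => [/andP[h1 h2] h3]; clear -h1 h2 h3; split; first (apply/andP; split); lia.
Qed.
End ForestLayout.

(** * Drawing a forest in the plane *)

Section ForestPlanar.
Variables (R : realType) (n : nat).
Implicit Types (w : seq ('I_n * 'I_n)).

Lemma set2_inj (T : finType) (x y a b : T) : [set x; y] = [set a; b] ->
  (x = a /\ y = b) \/ (x = b /\ y = a).
Proof.
move=> E.
have := set21 x y; rewrite E !inE => /orP[]/eqP h1; have := set22 x y; rewrite E !inE;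
  move=> /orP[]/eqP h2; have := set21 a b; rewrite -E !inE; have := set22 a b; rewrite -E !inE.
all: rewrite ?h1 ?h2; move=> /orP[]/eqP h3 /orP[]/eqP h4; subst; auto.
Qed.

Definition edges w : {set {set 'I_n}} := [set [set a.1; a.2] | a in w].

Lemma mem_edges w x y : ([set x; y] \in edges w) = adjw w x y.
Proof.
apply/imsetP/orP => [[[a b] aw /set2_inj /= [[-> ->]|[-> ->]]]|[h|h]]; auto.
  by exists (x, y).
by exists (y, x) => //; rewrite finset.setUC.
Qed.

Lemma edges_inv w e : e \in edges w -> exists u v, e = [set u; v] /\ adjw w u v.
Proof. by case/imsetP=> -[u v] uvw ->; exists u, v; split=> //; rewrite /adjw uvw. Qed.

Lemma edges_cons a w : edges (a :: w) = [set a.1; a.2] |: edges w.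
Proof.
apply/setP => e; rewrite !inE; apply/imsetP/orP => [[b]|].
  by rewrite inE => /predU1P[->|bw] ->; [left|right; apply: imset_f].
by case=> [/eqP ->|/imsetP[b bw ->]]; [exists a|exists b]; rewrite ?inE ?eqxx ?bw ?orbT.
Qed.

Lemma forest_edges w : forest w -> is_graph (edges w) /\ #|edges w| = size w.
Proof.
elim: w => [|a w IH] /=.
  split; last first.
    by apply/eqP; rewrite cards_eq0; apply/eqP/setP => e; rewrite inE; apply/imsetP => -[].
  by apply/forall_inP => e /imsetP[].
case/andP=> aw /IH[/forall_inP gw cw]; rewrite edges_cons; split.
  apply/forall_inP => e; rewrite !inE => /predU1P[->|/gw //].
  by rewrite cards2; have [E|//] := eqVneq a.1 a.2; rewrite E connect0 in aw.
rewrite cardsU1 cw mem_edges; case: (boolP (adjw _ _ _)) => [h|//].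
by rewrite (connect1 h) in aw.
Qed.

Local Open Scope ring_scope.

(** Two intervals that share [x] and do not cross are nested, and over the inner one the parabola of
    the strictly larger interval lies strictly higher. *)
Lemma arc_disjoint (a b a' b' x : R) : a < x < b -> a' < x < b' ->
  (x - a) * (b - x) = (x - a') * (b' - x) ->
  ~ (a < a' < b /\ b < b') -> ~ (a' < a < b' /\ b' < b) -> a = a' /\ b = b'.
Proof.
move=> /andP[ax xb] /andP[a'x xb'] E n1 n2.
have [aa'|aa'|aa'] := ltgtP a a'.
- have bb' : b' <= b by rewrite leNgt; apply/negP => h; apply: n1; split => //; lra.
  by exfalso; nra.
- have bb' : b <= b' by rewrite leNgt; apply/negP => h; apply: n2; split => //; lra.
  by exfalso; nra.
- split=> //; subst a'; have : (x - a) * (b - b') = 0 by nra.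
  by move=> /eqP; rewrite mulf_eq0 => /orP[]/eqP; lra.
Qed.

(* One-page book embedding: vertices on a line, edges drawn as parabolic arcs. *)
Lemma forest_planar w : forest w -> planar R (edges w).
Proof.
move=> fw; have [p [pI pX]] := forest_layout [set: 'I_n] fw.
pose P i : R := (p i)%:R.
have PI : injective P.
  by move=> x y /eqP; rewrite eqr_nat => /eqP; apply: pI; rewrite inE.
have PX a b c d : adjw w a b -> adjw w c d -> ~ (P a < P c < P b /\ P b < P d).
  by rewrite /P !ltr_nat; apply: pX; rewrite inE.
(* Orients each edge from left to right. *)
pose ends (e : {set 'I_n}) := [pick q : 'I_n * 'I_n | (e == [set q.1; q.2]) && (P q.1 < P q.2)].
pose lo e := if ends e is Some q then P q.1 else 0.
pose hi e := if ends e is Some q then P q.2 else 0.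
(* With x the first coordinate, the second one is (x - lo)(hi - x), the form compared in
   [arc_disjoint]. *)
pose gam e t : R * R := (lo e + t * (hi e - lo e), (t * (hi e - lo e)) * ((1 - t) * (hi e - lo e))).
have endsP e : e \in edges w -> exists u v, [/\ e = [set u; v], adjw w u v, P u < P v,
    lo e = P u & hi e = P v].
  move=> ew; rewrite /lo /hi /ends; case: pickP => [[u v] /andP[/eqP /= eE uv]|].
    by exists u, v; split=> //; rewrite -mem_edges -eE.
  have [u [v [-> uv]]] := edges_inv ew.
  have : P u != P v by apply: contraTneq uv => /PI ->; exact: forest_irrefl.
  rewrite neq_lt => /orP[h /(_ (u, v))|h /(_ (v, u))] /=; rewrite h ?eqxx //.
  by rewrite finset.setUC eqxx.
exists (fun i => (P i, 0)), gam; split; first by move=> x y [/PI].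
split.
  move=> e ew; have [u [v [eE uv Puv loE hiE]]] := endsP _ ew.
  split; first last.
    split; first last.
      split; first last.
        move=> t z /andP[t0 t1] [_] /eqP; rewrite loE hiE gt_eqF //.
        by rewrite !mulr_gt0 // subr_gt0.
      exists u, v; split=> //; rewrite /gam loE hiE !mul0r addr0 subrr !mul0r !mulr0 mul1r.
      by split=> //; congr pair; ring.
    move=> s t _ _ [+ _]; rewrite loE hiE => /addrI E; apply: mulIf E.
    by rewrite subr_eq0 gt_eqF.
  apply: continuous_subspaceT => t; set d := hi e - lo e.
  have c0 : (x * d @[x --> t] --> t * d)%classic by apply: cvgMr_tmp; exact: cvg_id.
  have c1 : (lo e + x * d @[x --> t] --> lo e + t * d)%classic.
    by apply: cvgD c0; exact: cvg_cst.
  have c2 : ((x * d) * ((1 - x) * d) @[x --> t] --> (t * d) * ((1 - t) * d))%classic.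
    apply: cvgM c0 _; apply: cvgMr_tmp; apply: cvgB; [exact: cvg_cst|exact: cvg_id].
  exact: (cvg_pair c1 c2).
move=> e e' s t ew ew' ee' /andP[s0 s1] /andP[t0 t1].
have [u [v [eE uv Puv loE hiE]]] := endsP _ ew.
have [u' [v' [e'E uv' Puv' loE' hiE']]] := endsP _ ew'.
rewrite /gam loE hiE loE' hiE' => -[Ex Ey].
have [//|sn0] := eqVneq s 0; have [//|sn1] := eqVneq s 1.
have {s0 sn0}s0 : 0 < s by rewrite lt_neqAle eq_sym sn0.
have {s1 sn1}s1 : s < 1 by rewrite lt_neqAle sn1.
have y0 : 0 < t * (P v' - P u') * ((1 - t) * (P v' - P u')).
  by rewrite -Ey !mulr_gt0 // subr_gt0.
have {}t0 : 0 < t by rewrite lt_neqAle t0 andbT; apply: contraTneq y0 => <-; rewrite !mul0r ltxx.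
have {}t1 : t < 1.
  by rewrite lt_neqAle t1 andbT; apply: contraTneq y0 => ->; rewrite subrr mul0r mulr0 ltxx.
pose x := P u + s * (P v - P u).
have [||||| h1 h2] := @arc_disjoint (P u) (P v) (P u') (P v') x.
- by rewrite /x; apply/andP; split; nra.
- by rewrite /x Ex; apply/andP; split; nra.
- have -> : (x - P u) * (P v - x) = s * (P v - P u) * ((1 - s) * (P v - P u)) by rewrite /x; ring.
  by rewrite Ey /x Ex; ring.
- exact: PX.
- exact: PX.
by move: ee'; rewrite eE e'E (PI _ _ h1) (PI _ _ h2) eqxx.
Qed.
End ForestPlanar.

(** * Counting sequences with a prescribed edge set *)

Section Labellings.
Variable n : nat.
Notation V := 'I_n.
Implicit Types (a : V * V) (w : seq (V * V)) (G : pred (V * V)) (D E : {set {set V}}).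

Definition arc_edge a : {set V} := [set a.1; a.2].

(* Every arc of w is either free (in G) or carries an edge of D, and each edge of
   D is carried exactly once. *)
Fixpoint uses_once G D w : bool :=
  if w is a :: w' then
    if G a then uses_once G D w'
    else (arc_edge a \in D) && uses_once G (D :\ arc_edge a) w'
  else D == finset.set0.

Lemma ffact_recr m d : (m.+1 ^_ d.+1 = m ^_ d.+1 + d.+1 * m ^_ d)%N.
Proof.
rewrite ffactSS ffactnSr [X in (X + _)%N]mulnC -mulnDl; have [dm|md] := leqP d m.
  by rewrite addnS subnK.
by rewrite ffact_small // !muln0.
Qed.

Lemma card_arcs_of_edge (e : {set V}) : #|e| = 2 -> #|[pred a | arc_edge a == e]| = 2.
Proof.
move=> /eqP/cards2P[x [y [xy ->]]].
transitivity #|[set (x, y); (y, x)]|; last by rewrite cards2 xpair_eqE (negbTE xy).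
apply: eq_card => -[u v]; rewrite !inE !xpair_eqE; apply/eqP/orP.
  by case/set2_inj => /= -[-> ->]; rewrite !eqxx; auto.
by case=> /andP[/eqP -> /eqP ->]; rewrite /arc_edge //= finset.setUC.
Qed.

(** Place the edges of [D] at distinct positions, orient each in 2 ways, and fill the other
    positions freely from [G]. It serves twice: with [G] empty it yields the multiplicity m! 2^m,
    and with [G] the arcs avoiding the inside of a tree it yields the first moment. *)
Lemma card_uses_once m G D :
  (forall e, e \in D -> #|e| = 2) -> (forall a, G a -> arc_edge a \notin D) ->
  \sum_(w : m.-tuple (V * V)) uses_once G D w
    = (m ^_ #|D| * 2 ^ #|D| * #|G| ^ (m - #|D|))%N.
Proof.
elim: m D => [|m IH] D D2 GD.
  rewrite (@big_tuple_nil _ _ _ _ (fun w => nat_of_bool (uses_once G D w))) /=.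
  have [->|D0] := eqVneq D finset.set0; first by rewrite cards0.
  by rewrite ffact_small ?card_gt0.
rewrite (@big_tuple_cons _ _ _ _ _ (fun w => nat_of_bool (uses_once G D w))).
rewrite (bigID G) /=.
have -> : \sum_(a | G a) \sum_(w : m.-tuple (V * V)) uses_once G D (a :: w) =
    (#|G| * (m ^_ #|D| * 2 ^ #|D| * #|G| ^ (m - #|D|)))%N.
  rewrite -(IH D) // -sum_nat_const; apply: eq_bigr => a Ga.
  by apply: eq_bigr => w _; rewrite /= Ga.
have -> : \sum_(a | ~~ G a) \sum_(w : m.-tuple (V * V)) uses_once G D (a :: w) =
    \sum_(e in D) (2 * (m ^_ #|D|.-1 * 2 ^ #|D|.-1 * #|G| ^ (m - #|D|.-1)))%N.
  transitivity (\sum_(a | arc_edge a \in D)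
     \sum_(w : m.-tuple (V * V)) uses_once G (D :\ arc_edge a) w).
    rewrite big_mkcond [RHS]big_mkcond; apply: eq_bigr => a _.
    have [Ga|Ga] /= := boolP (G a); first by rewrite (negbTE (GD _ Ga)).
    case: ifP => aD; first by apply: eq_bigr => w _; rewrite /= (negbTE Ga).
    by apply: big1 => w _; rewrite /= (negbTE Ga).
  rewrite (partition_big arc_edge (mem D)) //=; apply: eq_bigr => e eD.
  set X := (m ^_ _ * _ * _)%N.
  rewrite -(card_arcs_of_edge (D2 _ eD)) -sum_nat_const {}/X.
  apply: eq_big => [a|a /andP[_ /eqP ->]].
    by rewrite inE; have [->|] := eqVneq (arc_edge a) e; rewrite ?andbF ?eD.
  have DE : #|D|.-1 = #|D :\ e| by rewrite (cardsD1 e D) eD.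
  rewrite DE IH // => [e'|b /GD]; rewrite !inE; first by case/andP=> _ /D2.
  by rewrite negb_and => ->; rewrite orbT.
rewrite sum_nat_const; case: #|D| => [|d] /=.
  by rewrite addn0 !ffactn0 !expn0 !mul1n !subn0 expnS.
rewrite ffact_recr subSS expnS.
have [dm|md] := ltnP d m.
  by rewrite -(subnSK dm) expnS; ring.
rewrite [in LHS]ffact_small // mul0n muln0 add0n.
by rewrite (ffact_small (_ : m < d.+1)%N) // add0n; ring.
Qed.

Lemma uses_onceP G D w : uses_once G D w ->
  (forall a, a \in w -> G a || (arc_edge a \in D)) /\
  (forall e, e \in D -> exists2 a, a \in w & arc_edge a = e).
Proof.
elim: w D => [|a w IH] D /=; first by move=> /eqP ->; split=> // e; rewrite inE.
have [Ga|Ga] := boolP (G a).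
  move=> /IH[h1 h2]; split=> [b|e /h2[b bw <-]].
    by rewrite inE => /predU1P[->|/h1 //]; rewrite Ga.
  by exists b; rewrite // inE bw orbT.
move=> /andP[aD /IH[h1 h2]]; split=> [b|e eD].
  rewrite inE => /predU1P[->|/h1]; first by rewrite aD orbT.
  by rewrite !inE => /orP[->//|/andP[_ ->]]; rewrite orbT.
have [->|ea] := eqVneq e (arc_edge a); first by exists a; rewrite ?mem_head.
have [|b bw <-] := h2 e; first by rewrite !inE ea.
by exists b; rewrite // inE bw orbT.
Qed.

(** A sequence with only [#|E|] entries has no room to repeat an edge while still covering [E]. *)
Lemma edges_eq_uses_once w E : size w = #|E| ->
  (edges w == E) = uses_once pred0 E w.
Proof.
elim: w E => [|a w IH] E /= wE.
  rewrite eq_sym; congr (_ == _); apply/setP => e; rewrite inE.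
  by apply/imsetP => -[].
rewrite edges_cons -/(arc_edge a); apply/eqP/andP => [EE|[aE]].
  have aE : arc_edge a \in E by rewrite -EE setU11.
  split=> //; rewrite -IH; last by move: wE; rewrite (cardsD1 (arc_edge a) E) aE => -[].
  rewrite eq_sym eqEcard; apply/andP; split.
    by apply/fintype.subsetP => e; rewrite -EE !inE => /andP[/negbTE ->].
  apply: leq_trans (leq_imset_card _ _) _.
  apply: leq_trans (card_size w) _.
  by rewrite -ltnS wE (cardsD1 (arc_edge a) E) aE.
rewrite -IH; last by move: wE; rewrite (cardsD1 (arc_edge a) E) aE => -[].
by move/eqP=> ->; rewrite finset.setD1K.
Qed.

Lemma card_labellings m E : is_graph E -> #|E| = m ->
  \sum_(w : m.-tuple (V * V)) (edges w == E) = (m`! * 2 ^ m)%N.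
Proof.
move=> /forall_inP gE Em.
have e0 : #|[pred x : V * V | false]| = 0%N by apply: eq_card0.
under eq_bigr => w _ do rewrite edges_eq_uses_once ?size_tuple ?Em //.
rewrite card_uses_once //; last by move=> e /gE/eqP.
by rewrite Em ffactnn subnn expn0 muln1.
Qed.

(** Equal multiplicities let a uniform sequence conditioned on its edge set lying in [A] stand for a
    uniform element of [A]. *)
Lemma sum_labellings (R : nzRingType) m (A : {set {set {set V}}}) (f : {set {set V}} -> R) :
  (forall E, E \in A -> is_graph E /\ #|E| = m) ->
  (\sum_(w : m.-tuple (V * V) | edges w \in A) f (edges w) =
   (m`! * 2 ^ m)%N%:R * \sum_(E in A) f E)%R.
Proof.
move=> gA; rewrite (partition_big (fun w : m.-tuple (V * V) => edges w) (mem A)) //=.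
rewrite big_distrr /=; apply: eq_bigr => E EA; have [gE Em] := gA _ EA.
rewrite -(card_labellings gE Em) natr_sum mulr_suml big_mkcond /=.
rewrite [RHS](eq_bigr (fun w : m.-tuple _ => if edges w == E then f E else 0%R)).
  by apply: eq_bigr => w _; case: eqP => [->|]; rewrite ?EA ?andbF.
by move=> w _; case: eqP; rewrite ?mul1r ?mul0r.
Qed.
End Labellings.

(** * Conditioning a function with bounded differences *)

Section Concentration.
Local Open Scope ring_scope.
Variables (R : realType) (T : finType).
Implicit Types (f : seq T -> R) (B s h : R).

Lemma le_of_eq (x y : R) : x = y -> x <= y.
Proof. by move->. Qed.

(** From e^(-x) >= 1 - x and (1 + x + 2 x^2)(1 - x) = 1 + x^2 (1 - 2 x) >= 1. *)
Lemma expR_le_quad (x : R) : `|x| <= 1 / 2 -> expR x <= 1 + x + 2 * x ^+ 2.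
Proof.
rewrite ler_norml => /andP[x0 x1].
have -> : expR x = (expR (- x))^-1 by rewrite expRN invrK.
rewrite -div1r ler_pdivrMr ?expR_gt0 //.
apply: (@le_trans _ _ ((1 + x + 2 * x ^+ 2) * (1 - x))); last first.
  by rewrite ler_wpM2l ?expR_ge1Dx //; nra.
have : 0 <= x ^+ 2 * (1 - 2 * x) by rewrite mulr_ge0 ?sqr_ge0 //; lra.
by rewrite (_ : _ * (1 - x) = 1 + x ^+ 2 * (1 - 2 * x)); [lra|ring].
Qed.

Lemma sum_expR_le (g : T -> R) (c : R) : 0 <= c <= 1 / 2 ->
  \sum_a g a = 0 -> (forall a, `|g a| <= c) ->
  \sum_a expR (g a) <= #|T|%:R * expR (2 * c ^+ 2).
Proof.
move=> /andP[c0 c1] g0 gc.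
apply: (@le_trans _ _ (\sum_a (1 + g a + 2 * c ^+ 2))).
  apply: ler_sum => a _; apply: le_trans (expR_le_quad (le_trans (gc a) c1)) _.
  rewrite lerD2l ler_pM2l // -[g a ^+ 2]real_normK ?num_real //.
  by apply: lerXn2r; rewrite ?nnegrE.
rewrite !big_split /= g0 addr0 !sumr_const -mulrnDl -[_ *+ #|_|]mulr_natl.
by apply: ler_wpM2l => //; exact: expR_ge1Dx.
Qed.

(** Swapping [a] and [b] makes the bound two-sided. Working on [seq] rather than tuples lets the
    property pass to [fun w => f (a :: w)] in inductions. *)
Definition lipschitz_entries f B :=
  forall w1 a b w2, f (w1 ++ a :: w2) <= f (w1 ++ b :: w2) + B.

Definition tuple_mean M f := (\sum_(w : M.-tuple T) f w) / #|T|%:R ^+ M.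

Lemma tuple_mean_cons M f : (0 < #|T|)%N ->
  tuple_mean M.+1 f = (\sum_a tuple_mean M (fun w => f (a :: w))) / #|T|%:R.
Proof.
move=> T0; rewrite /tuple_mean (@big_tuple_cons _ _ _ _ _ f) -mulr_suml exprSr.
by rewrite invfM mulrA.
Qed.

(** The martingale argument behind the Azuma inequality: reveal the first entry. The conditional
    means [mu' a] average to [mu] and stay within [B] of it, so [sum_expR_le] yields one factor and
    induction the others. *)
Lemma mgf_le M f B s : (0 < #|T|)%N -> 0 <= B -> `|s| * B <= 1 / 2 ->
  lipschitz_entries f B ->
  \sum_(w : M.-tuple T) expR (s * (f w - tuple_mean M f))
    <= #|T|%:R ^+ M * expR (M%:R * (2 * (`|s| * B) ^+ 2)).
Proof.
move=> T0 B0 sB; elim: M f => [|M IH] f fB.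
  rewrite (@big_tuple_nil _ _ _ _ (fun w => expR (s * (f w - tuple_mean 0 f)))).
  rewrite /tuple_mean (@big_tuple_nil _ _ _ _ f) expr0 divr1 subrr mulr0 mul0r.
  by rewrite expR0 mulr1.
have N0 : 0 < #|T|%:R :> R by rewrite ltr0n.
set mu := tuple_mean _ f; pose mu' a := tuple_mean M (fun w => f (a :: w)).
have muE : mu = (\sum_a mu' a) / #|T|%:R by exact: tuple_mean_cons.
have dmu a b : mu' a <= mu' b + B.
  rewrite /mu' /tuple_mean ler_pdivrMr ?exprn_gt0 // mulrDl divfK ?gt_eqF ?exprn_gt0 //.
  have -> : B * #|T|%:R ^+ M = \sum_(w : M.-tuple T) B.
    by rewrite sumr_const card_tuple -natrX mulr_natr.
  by rewrite -big_split /=; apply: ler_sum => w _; exact: (fB [::]).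
have muN : mu * #|T|%:R = \sum_b mu' b by rewrite muE divfK // gt_eqF.
have dmean a : `|mu' a - mu| <= B.
  have cst (c : R) : c * #|T|%:R = \sum_(b : T) c by rewrite sumr_const mulr_natr.
  rewrite ler_norml; apply/andP; split.
    rewrite lerBrDl -(ler_pM2r N0) mulrDl mulNr muN !cst -sumrN -big_split /=.
    by apply: ler_sum => b _; rewrite /= lerBlDr.
  rewrite lerBlDr -(ler_pM2r N0) mulrDl muN !cst -big_split /=.
  by apply: ler_sum => b _; rewrite addrC.
rewrite (@big_tuple_cons _ _ _ _ _ (fun w => expR (s * (f w - mu)))).
set K := #|T|%:R ^+ M * expR (M%:R * (2 * (`|s| * B) ^+ 2)).
apply: (@le_trans _ _ (\sum_a (expR (s * (mu' a - mu)) * K))).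
  apply: ler_sum => a _.
  rewrite (eq_bigr (fun w : M.-tuple T => expR (s * (mu' a - mu)) *
      expR (s * (f (a :: w) - mu' a)))).
    rewrite -mulr_sumr ler_wpM2l ?expR_ge0 //; apply: (IH (fun w => f (a :: w))).
    by move=> w1 b c w2; exact: (fB (a :: w1)).
  by move=> w _; rewrite -expRD; congr expR; ring.
rewrite -mulr_suml.
apply: (@le_trans _ _ (#|T|%:R * expR (2 * (`|s| * B) ^+ 2) * K)).
  rewrite ler_wpM2r ?mulr_ge0 ?exprn_ge0 ?expR_ge0 //.
  apply: sum_expR_le; first by rewrite mulr_ge0.
    by rewrite -mulr_sumr sumrB sumr_const -[_ *+ #|_|]mulr_natr muN subrr mulr0.
  by move=> a; rewrite normrM ler_wpM2l.
rewrite /K mulrACA -exprS -expRD; apply: le_of_eq; congr (_ * expR _).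
by rewrite -[M.+1%:R]natr1; ring.
Qed.

(* Gibbs' variational inequality. *)
Lemma conditional_mean_ge M f B s h (A : pred (M.-tuple T)) :
  (0 < #|T|)%N -> 0 <= B -> 0 < s -> s * B <= 1 / 2 -> lipschitz_entries f B ->
  expR (- h) * #|T|%:R ^+ M <= #|A|%:R -> (0 < #|A|)%N ->
  #|A|%:R * (tuple_mean M f - 2 * s * M%:R * B ^+ 2 - h / s)
    <= \sum_(w in A) f w.
Proof.
move=> T0 B0 s0 sB fB Ah A0; set mu := tuple_mean M f.
have a0 : 0 < #|A|%:R :> R by rewrite ltr0n.
pose X := (\sum_(w in A) (mu - f w)) / #|A|%:R.
have XE : #|A|%:R * X = #|A|%:R * mu - \sum_(w in A) f w.
  by rewrite /X mulrC divfK ?gt_eqF // sumrB sumr_const mulr_natl.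
have := @mgf_le M f B (- s) T0 B0; rewrite normrN gtr0_norm // => /(_ sB fB) mgf.
have low : #|A|%:R * expR (s * X) <= \sum_(w : M.-tuple T) expR (- s * (f w - mu)).
  apply: (@le_trans _ _ (\sum_(w in A) expR (- s * (f w - mu)))); last first.
    rewrite [leRHS](bigID (mem A)) /= lerDl; apply: sumr_ge0 => w _; exact: expR_ge0.
  (* Jensen's inequality through the tangent of exp at [s * X]; the linear term sums to zero over
     [A] by the choice of [X]. *)
  apply: (@le_trans _ _ (\sum_(w in A) expR (s * X) * (1 + (s * (mu - f w) - s * X)))).
    rewrite -mulr_sumr mulrC ler_wpM2l ?expR_ge0 //.
    rewrite big_split sumr_const sumrB -mulr_sumr sumr_const /=.
    rewrite -[X in _ - X]mulr_natl.
    have -> : \sum_(w in A) (mu - f w) = #|A|%:R * X by rewrite /X mulrC divfK ?gt_eqF.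
    by rewrite mulrCA subrr addr0.
  apply: ler_sum => w _; apply: le_trans (ler_wpM2l (expR_ge0 _) (expR_ge1Dx _)) _.
  by rewrite -expRD ler_expR; apply: le_of_eq; ring.
have : expR (s * X) <= expR (h + M%:R * (2 * (s * B) ^+ 2)).
  rewrite -(ler_pM2l a0); apply: le_trans low _; apply: le_trans mgf _.
  rewrite expRD [leRHS]mulrA ler_wpM2r ?expR_ge0 //.
  by rewrite -(ler_pM2l (expR_gt0 (- h))) mulrC [leRHS]mulrCA -expRD addNr expR0 mulr1 mulrC.
rewrite ler_expR -(ler_pM2l a0) mulrCA XE => H.
have : #|A|%:R * mu - \sum_(w in A) f w <= #|A|%:R * (2 * s * M%:R * B ^+ 2 + h / s).
  rewrite -(ler_pM2l s0); apply: le_trans H _; apply: le_of_eq.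
  by field; rewrite gt_eqF.
by rewrite -addrA -opprD mulrBr lerBlDr addrC lerBlDr.
Qed.
End Concentration.

(** * Explorations of ordered trees *)

Section Addresses.
Implicit Types (S : {fset (seq nat)}) (u v : seq nat).

Definition nbr u v := is_child u v || is_child v u.

Lemma is_childP u v : reflect (exists i, v = rcons u i) (is_child u v).
Proof.
apply: (iffP andP) => [[/eqP sv /eqP tv]|[i ->]]; last first.
  by split; rewrite ?size_rcons ?eqxx // -cats1 take_size_cat.
elim/last_ind: v sv tv => // v i _; rewrite size_rcons => -[sv] tv; exists i.
by move: tv; rewrite -sv -cats1 take_size_cat // cats1 => ->.
Qed.

Lemma nbr_sym u v : nbr u v = nbr v u.
Proof. exact: orbC. Qed.

Lemma nbr_rcons u i : nbr u (rcons u i).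
Proof. by rewrite /nbr; apply/orP; left; apply/is_childP; exists i. Qed.

Lemma rcons_injr u : injective (rcons u).
Proof. by move=> i j /rcons_inj[]. Qed.

Section Tree.
Variables (L : nat) (S : {fset (seq nat)}).
Hypothesis tS : trunc_tree L S.

Lemma tree_root : [::] \in S. Proof. by case: tS. Qed.

Lemma tree_parent u i : rcons u i \in S -> u \in S.
Proof. by move=> /(proj1 (proj2 tS)) []. Qed.

Lemma tree_size u : u \in S -> (size u <= L)%N.
Proof. by move/(proj2 (proj2 tS)). Qed.

Lemma tree_interior u i : rcons u i \in S -> (size u < L)%N.
Proof. by move=> /tree_size; rewrite size_rcons. Qed.

(** Finiteness provides a least missing child index, and closure under left siblings makes the
    children an initial segment. *)
Lemma tree_childE u i : (rcons u i \in S) = (i < nchildren S u)%N.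
Proof.
have ex : exists i, rcons u i \notin S.
  apply: contrapT => h.
  have hS j : rcons u j \in S by apply: contrapT => /negP h'; apply: h; exists j.
  have : (size [seq rcons u j | j <- iota 0 #|` S|.+1] <= #|` S|)%N.

    apply: uniq_leq_size.
      by rewrite map_inj_uniq ?iota_uniq //; exact: rcons_injr.
    by move=> x /mapP[j _ ->]; exact: hS.
  by rewrite size_map size_iota ltnn.
have [d /negP dS dmin] := ex_minnP ex.
have dE j : (rcons u j \in S) = (j < d)%N.
  apply/idP/idP => [jS|jd]; last by apply: contraLR (jd) => /dmin; rewrite -leqNgt.
  rewrite ltnNge leq_eqVlt; apply/negP => /orP[/eqP dj|dj]; first by rewrite dj in dS.
  by apply: dS; apply: (proj2 (proj1 (proj2 tS) _ _ jS)).
rewrite dE; congr (_ < _)%N; rewrite /nchildren.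
have -> : [fset v in S | is_child u v]%fset = seq_fset tt [seq rcons u j | j <- iota 0 d].
  apply/fsetP => v; rewrite !inE seq_fsetE; apply/andP/mapP => [[vS /is_childP[j vj]]|].
    by exists j => //; rewrite mem_iota add0n /= -dE -vj.
  move=> [j]; rewrite mem_iota add0n /= -dE => jS ->; split=> //.
  by apply/is_childP; exists j.
rewrite size_seq_fset undup_id ?size_map ?size_iota //.
by rewrite map_inj_uniq ?iota_uniq //; exact: rcons_injr.
Qed.
End Tree.
End Addresses.

(** * Explorations and the balls they determine *)

Section WeakType.
Variables (n : nat).
Notation V := 'I_n.
Implicit Types (S : {fset (seq nat)}) (u v : seq nat) (e : rel V) (f : seq nat -> V).

(* Neighbourhoods are prescribed only at depth < L.  Edges between vertices at
   depth L stay unconstrained: a vertex of unbounded degree at depth L would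
   otherwise destroy the Lipschitz bound.  An exploration of depth l.+1 still
   determines the ball of radius l.  Ordering siblings by label makes the
   explored tree unique. *)
Definition explores S L e f :=
  [/\ {in S &, injective f},
      (forall u i j, rcons u j \in S -> (i < j)%N -> (f (rcons u i) < f (rcons u j))%N)
    & (forall u, u \in S -> (size u < L)%N -> forall y,
        e (f u) y <-> exists2 v, v \in S & nbr u v /\ y = f v)].

(** The labels of the children are the neighbours of [f u] other than the label of its parent. Being
    sorted, their list is determined by the graph, [f u] and the parent, which is the inductive step
    of uniqueness. *)
Lemma explores_children S L e f u : trunc_tree L S -> explores S L e f ->
  u \in S -> (size u < L)%N ->
  let s := [seq (f (rcons u i) : nat) | i <- iota 0 (nchildren S u)] in
  sorted ltn s /\ (forall y : V, ((y : nat) \in s) <->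
     e (f u) y /\ (forall p i, u = rcons p i -> y <> f p)).
Proof.
move=> tS [fI fS fN] uS uL s; split.
  rewrite /s; move: (leqnn (nchildren S u)); move: {1 3}(nchildren S u) => d dn.
  rewrite sorted_map; apply: (@sub_in_sorted _ [pred i | i < nchildren S u] ltn).
  - move=> i j _ jn; apply: fS.
    by rewrite (tree_childE tS).
  - by apply/allP => i; rewrite mem_iota /= add0n => id; exact: leq_trans dn.
  - exact: iota_ltn_sorted.
move=> y; split=> [/mapP[i]|[ey np]].
  rewrite mem_iota add0n /= -(tree_childE tS) => iS /val_inj ->; split.
    by apply/fN => //; exists (rcons u i) => //; split=> //; exact: nbr_rcons.
  move=> p j up E; have pS : p \in S by apply: (tree_parent tS (i := j)); rewrite -up.
  have /(congr1 size) := fI _ _ iS pS E.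
  by rewrite up !size_rcons; lia.
have [v vS [uv yE]] := (fN _ uS uL y).1 ey; rewrite yE in np *.
case/orP: uv => /is_childP[i vE]; last by case: (np v i).
rewrite vE; apply/mapP; exists i => //.
by rewrite mem_iota add0n -(tree_childE tS) -vE.
Qed.

Lemma explores_unique S S' L e f f' : trunc_tree L S -> trunc_tree L S' ->
  explores S L e f -> explores S' L e f' -> f [::] = f' [::] ->
  S = S' /\ {in S, f =1 f'}.
Proof.
move=> tS tS' ef ef' r.
suff H s u : (size u <= s)%N -> (u \in S) = (u \in S') /\ (u \in S -> f u = f' u).
  split; first by apply/fsetP => u; case: (H _ u (leqnn _)).
  by move=> u uS; case: (H _ u (leqnn _)) => _; apply.
elim: s u => [|s IH] u.
  by rewrite leqn0 size_eq0 => /eqP ->; rewrite (tree_root tS) (tree_root tS').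
case/lastP: u => [|u i]; first by rewrite (tree_root tS) (tree_root tS').
rewrite size_rcons ltnS => us.
have [uSS' uf] := IH u us.
have [uL|Lu] := ltnP (size u) L; last first.
  have out S0 : trunc_tree L S0 -> (rcons u i \in S0) = false.
    by move=> t0; apply/negP => /(tree_interior t0); rewrite ltnNge Lu.
  by rewrite (out _ tS) (out _ tS').
have [uS|uS] := boolP (u \in S); last first.
  have out S0 : trunc_tree L S0 -> u \notin S0 -> (rcons u i \in S0) = false.
    by move=> t0; apply: contraNF; exact: (tree_parent t0).
  by rewrite (out _ tS) // (out _ tS') -?uSS' ?uS.
have uS' := uS; rewrite uSS' in uS'; have fu := uf uS.
have [so sP] := explores_children tS ef uS uL.
have [so' sP'] := explores_children tS' ef' uS' uL.
have E : [seq (f (rcons u i) : nat) | i <- iota 0 (nchildren S u)] =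
         [seq (f' (rcons u i) : nat) | i <- iota 0 (nchildren S' u)].
  apply: (irr_sorted_eq ltn_trans ltnn so so') => y.
  have par p j : u = rcons p j -> f p = f' p.
    move=> up; have [|_] := IH p; last by apply; apply: (tree_parent tS (i := j)); rewrite -up.
    by move: us; rewrite up size_rcons => /ltnW.
  apply/idP/idP => /mapP[j jd ->].
    apply/sP'; have /sP[] : (f (rcons u j) : nat) \in
      [seq (f (rcons u i) : nat) | i <- iota 0 (nchildren S u)] by apply/mapP; exists j.
    by rewrite fu => e1 e2; split=> // p j' up; rewrite -(par _ _ up); exact: e2 up.
  apply/sP; have /sP'[] : (f' (rcons u j) : nat) \in
    [seq (f' (rcons u i) : nat) | i <- iota 0 (nchildren S' u)] by apply/mapP; exists j.
  by rewrite fu => e1 e2; split=> // p j' up; rewrite (par _ _ up); exact: e2 up.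
have dE : nchildren S u = nchildren S' u.
  by move/(congr1 size): E; rewrite !size_map !size_iota.
rewrite !(tree_childE tS, tree_childE tS') dE; split=> // id.
move/(congr1 (fun s => nth 0 s i)): E; rewrite -dE !(nth_map 0) ?size_iota ?dE //.
by rewrite nth_iota // add0n => /val_inj.
Qed.
End WeakType.

Section BallType.
Variables (n l : nat) (E : {set {set 'I_n}}) (S : {fset (seq nat)}) (f : seq nat -> 'I_n).
Hypothesis tS : trunc_tree l.+1 S.
Hypothesis ef : explores S l.+1 (adj E) f.

(** Applied with [h] = [l] to an exploration of depth [l.+1], it discards the level whose mutual
    adjacencies are unconstrained. *)
Definition truncate (h : nat) (S0 : {fset (seq nat)}) := [fset u in S0 | (size u <= h)%N]%fset.

Lemma in_truncate h S0 u : (u \in truncate h S0) = (u \in S0) && (size u <= h)%N.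
Proof. by rewrite !inE. Qed.

Lemma nbr_size u v : nbr u v -> (size v <= (size u).+1)%N.
Proof. by case/orP => /is_childP[i ->]; rewrite size_rcons //; lia. Qed.

Lemma ball_explores j (y : 'I_n) : (j <= l.+1)%N ->
  y \in Defs.ball E (f [::]) j <-> exists2 u, u \in S & (size u <= j)%N /\ y = f u.
Proof.
have [_ _ fN] := ef.
elim: j y => [|j IH] y jl /=.
  rewrite inE; split=> [/eqP ->|[u uS []]]; first by exists [::]; rewrite ?(tree_root tS).
  by rewrite leqn0 size_eq0 => /eqP -> ->.
have {}IH x := IH x (ltnW jl).
rewrite !inE; split=> [/orP[/IH[u uS [uj ->]]|/exists_inP[x /IH[u uS [uj ->]]]]|[u uS [uj ->]]].
- by exists u => //; split=> //; exact: leqW.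
- have uL : (size u < l.+1)%N by exact: leq_ltn_trans uj jl.
  move=> /(fN _ uS uL)[v vS [uv ->]]; exists v => //; split=> //.
  by apply: leq_trans (nbr_size uv) _; rewrite ltnS.
have [uj'|uj'] := leqP (size u) j; first by apply/orP; left; apply/IH; exists u.
apply/orP; right; apply/exists_inP.
case/lastP: u uS uj uj' => // p i uS; rewrite size_rcons !ltnS => uj uj'.
have pS := tree_parent tS uS; exists (f p); first by apply/IH; exists p.
apply/fN => //; first exact: leq_ltn_trans uj jl.
by exists (rcons p i) => //; split=> //; exact: nbr_rcons.
Qed.

Lemma adj_explores u v : u \in truncate l S -> v \in truncate l S ->
  adj E (f u) (f v) = nbr u v.
Proof.
have [fI _ fN] := ef.
rewrite !in_truncate => /andP[uS ul] /andP[vS vl]; apply/idP/idP => [/(fN _ uS)|uv].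
  by case=> // v' v'S [uv' /fI -> //].
by apply/(fN _ uS) => //; exists v.
Qed.

Lemma ball_iso_explores k (H : {set {set 'I_k}}) (rH : 'I_k) :
  ball_iso E (f [::]) l H rH <-> tree_iso (truncate l S) H rH.
Proof.
have [fI _ fN] := ef.
(* In Defs, setT is the full classical set, not the full finite set. *)
have imT (h : {ffun 'I_k -> 'I_n}) :
    [set h x | x in classical_sets.setT] = [set h x | x in finset.setT].
  by apply/setP => y; apply/imsetP/imsetP => -[i _ ->]; exists i; rewrite ?in_setT ?finset.in_setT.
have fI' : {in truncate l S &, injective f}.
  by move=> u v; rewrite !in_truncate => /andP[uS _] /andP[vS _]; exact: fI.
have rS : [::] \in truncate l S by rewrite in_truncate (tree_root tS).
have ballE : Defs.ball E (f [::]) l = [set f (val s) | s : truncate l S].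
  apply/setP => y; apply/idP/imsetP.
    move/(ball_explores _ (leqnSn l)) => [u uS [ul ->]].
    have uT : u \in truncate l S by rewrite in_truncate uS.
    by exists [` uT]%fset.
  move=> [s _ ->]; apply/(ball_explores _ (leqnSn l)); exists (val s).
    by have := fsvalP s; rewrite in_truncate => /andP[].
  by have := fsvalP s; rewrite in_truncate => /andP[].
have cardB : #|Defs.ball E (f [::]) l| = #|` truncate l S|.
  rewrite ballE card_imset ?cardfE // => s t /fI' E0; apply: val_inj; apply: E0; exact: fsvalP.
split.
  move=> /existsP[h /and4P[/injectiveP hI /eqP hB /eqP hr /forallP hA]].
  have gex i : exists u, u \in truncate l S /\ f u = h i.
    have : h i \in Defs.ball E (f [::]) l by rewrite -hB imset_f // in_setT.
    by rewrite ballE => /imsetP[s _ ->]; exists (val s); split=> //; exact: fsvalP.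
  have [g gP] := choice gex.
  have gS i : g i \in truncate l S by case: (gP i).
  have gE i : f (g i) = h i by case: (gP i).
  exists g; split; first by move=> i j ij; apply: hI; rewrite -!gE ij.
  split=> //; split; first by rewrite -cardB -hB imT card_imset // cardsT card_ord.
  split; first by apply: fI'; rewrite ?gE.
  by move=> i j; have /forallP /(_ j) /eqP -> := hA i; rewrite -!gE adj_explores.
move=> [g [gI [gS [gk [gr gA]]]]].
have hI : injective [ffun i => f (g i)].
  by move=> i j; rewrite !ffunE => /fI' h; apply: gI; apply: h.
apply/existsP; exists [ffun i => f (g i)]; apply/and4P; split.
- exact/injectiveP.
- rewrite imT eqEcard cardB gk card_imset // cardsT card_ord leqnn andbT.
  apply/fintype.subsetP => _ /imsetP[i _ ->]; rewrite ffunE ballE.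
  by apply/imsetP; exists [` gS i]%fset.
- by rewrite ffunE gr.
- apply/forallP => i; apply/forallP => j; rewrite !ffunE adj_explores //.
  exact/eqP.
Qed.
End BallType.

(** * Number of explorations and its Lipschitz bound *)

Section Explorations.
Variables (n L : nat) (S : {fset (seq nat)}) (v0 : 'I_n).
Hypothesis tS : trunc_tree L S.
Notation V := 'I_n.
Implicit Types (w : seq (V * V)) (phi : {ffun S -> V}) (e : rel V).

(** Explorations are counted in the finite type of maps on [S], whereas [explores] takes maps on all
    addresses; [v0] fills the rest. *)
Definition extend phi (u : seq nat) : V := if insub u is Some s then phi s else v0.

Lemma extend_val phi (s : S) : extend phi (val s) = phi s.
Proof. by rewrite /extend valK. Qed.

Definition explorer e phi : bool := `[< explores S L e (extend phi) >].

Lemma explorer_inj e phi phi' : explorer e phi -> explorer e phi' ->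
  extend phi [::] = extend phi' [::] -> phi = phi'.
Proof.
move=> /asboolP h /asboolP h' r; have [_ E] := explores_unique tS tS h h' r.
by apply/ffunP => s; rewrite -!extend_val; apply: E; exact: fsvalP.
Qed.

Lemma card_explorer_through w u (x : V) : u \in S -> (size u < L)%N ->
  (#|[pred phi | explorer (adjw w) phi && (extend phi u == x)]| <= #|` S| ^ size u)%N.
Proof.
elim/last_ind: u x => [|p i IH] x uS uL.
  rewrite expn0; apply/card_le1_eqP => phi phi'; rewrite !inE.
  move=> /andP[h /eqP r] /andP[h' /eqP r'].
  by apply: explorer_inj h' h _; rewrite r r'.
set P := [pred phi | _].
have [->//|/card_gt0P[psi]] := posnP #|P|; rewrite inE => /andP[/asboolP hpsi /eqP psix].
have [_ _ psiN] := hpsi.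
have pS := tree_parent tS uS.
have pL : (size p < L)%N by apply: ltnW; move: uL; rewrite size_rcons.
have Nx : (#|[pred y | adjw w x y]| <= #|` S|)%N.

  apply: (@leq_trans #|[set psi s | s : S]|); last by rewrite cardfE leq_imset_card.
  apply/subset_leq_card/fintype.subsetP => y; rewrite inE -psix.
  move=> /(psiN _ uS uL)[v vS [_ ->]]; apply/imsetP; exists [` vS]%fset => //.
  by rewrite -extend_val.
apply: (@leq_trans (\sum_(y | adjw w x y)
   #|[pred phi | explorer (adjw w) phi && (extend phi p == y)]|)); last first.
  apply: (@leq_trans (\sum_(y | adjw w x y) #|` S| ^ size p)).
    by apply: leq_sum => y _; exact: IH.
  by rewrite sum_nat_const size_rcons expnS leq_mul2r Nx orbT.
under eq_bigr => y _ do rewrite -sum1_card big_mkcond.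
rewrite exchange_big -sum1_card big_mkcond /=; apply: leq_sum => phi _.
rewrite inE; case: ifP => // /andP[hphi /eqP phix].
have [_ _ phiN] := asboolP _ hphi.
rewrite (bigD1 (extend phi p)) /=; first by rewrite inE hphi eqxx.
rewrite -phix; apply/(phiN _ uS uL); exists p => //; split=> //.
by rewrite nbr_sym nbr_rcons.
Qed.

Definition nexplorer w := #|[pred phi | explorer (adjw w) phi]|.

(** An exploration is lost only if an interior address sits at an end of the old or the new arc: 4
    ends, at most [#|] S|[addresses, and at most]#|[S| ^ L] explorations through each such pair. *)
Lemma nexplorer_lipschitz w1 a b w2 :
  (nexplorer (w1 ++ a :: w2) <=
   nexplorer (w1 ++ b :: w2) + 4 * #|` S| * #|` S| ^ L)%N.
Proof.
set w := w1 ++ a :: w2; set w' := w1 ++ b :: w2.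
pose X := [:: a.1; a.2; b.1; b.2].
pose inner := [pred s : S | size (val s) < L].
have S0 : (0 < #|` S|)%N by rewrite cardfs_gt0; apply/fset0Pn; exists [::]; exact: tree_root tS.
have key phi : explorer (adjw w) phi -> explorer (adjw w') phi ||
    has (fun x => [exists s : S, inner s && (extend phi (val s) == x)]) X.
  move=> /asboolP[fI fS fN]; case: hasP => [_|nX]; rewrite ?orbT // orbF.
  apply/asboolP; split=> // u uS uL y; rewrite -fN //.
  have ua x : x \in X -> (extend phi u == x) = false.
    move=> xX; apply/negP => ux; apply: nX; exists x => //.
    by apply/existsP; exists [` uS]%fset; rewrite /= uL ux.
  rewrite /adjw !mem_cat !inE.
  have E c : c.1 \in X -> c.2 \in X ->
      ((extend phi u, y) == c) = false /\ ((y, extend phi u) == c) = false.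
    by case: c => c1 c2 /= h1 h2; rewrite !xpair_eqE !ua // andbF.
  have [aX1 aX2 bX1 bX2] : [/\ a.1 \in X, a.2 \in X, b.1 \in X & b.2 \in X].
    by rewrite !inE !eqxx !orbT.
  by have [-> ->] := E a aX1 aX2; have [-> ->] := E b bX1 bX2.
rewrite /nexplorer -!sum1_card.
apply: (@leq_trans (\sum_(phi | explorer (adjw w') phi) 1 +
  \sum_(x <- X) \sum_(s | inner s)
    #|[pred phi | explorer (adjw w) phi && (extend phi (val s) == x)]|)).
  have -> : \sum_(x <- X) \sum_(s | inner s)
      #|[pred phi | explorer (adjw w) phi && (extend phi (val s) == x)]| =
    \sum_phi \sum_(x <- X) \sum_(s | inner s)
       (explorer (adjw w) phi && (extend phi (val s) == x) : nat).
    rewrite [RHS]exchange_big; apply: eq_bigr => x _ /=.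
    rewrite [RHS]exchange_big; apply: eq_bigr => s _ /=.
    by rewrite -sum1_card big_mkcond; apply: eq_bigr => phi _; rewrite inE; case: (_ && _).
  rewrite big_mkcond [X in X + _]big_mkcond -big_split; apply: leq_sum => phi _ /=.
  rewrite !inE; case: ifP => // /[dup] hphi /key /orP[->|/hasP[x xX /existsP[s /andP[si sx]]]].
    exact: leq_addr.
  rewrite (big_rem x) //= (bigD1 s) //= sx /=; lia.
rewrite leq_add2l; apply: (@leq_trans (\sum_(x <- X) \sum_(s | inner s) #|` S| ^ L)).
  apply: leq_sum => x _; apply: leq_sum => s si.
  apply: leq_trans (card_explorer_through _ _ (fsvalP s) si) _.
  by rewrite leq_pexp2l // ltnW.
rewrite big_const_seq count_predT iter_addn_0 sum_nat_const mulnC -mulnA leq_mul2l /=.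
by rewrite leq_mul2r cardfE max_card orbT.
Qed.
End Explorations.

(** * The expected number of explorations *)

Section BlockIncreasing.
Variables (n : nat) (S B : finType) (beta : S -> B) (rank : S -> nat).
Implicit Types (phi : {ffun S -> 'I_n}) (s t : S) (p : {perm S}).

Definition block_increasing phi : bool := injectiveb phi &&
  [forall s, forall t, (beta s == beta t) ==> (rank s < rank t) ==> (phi s < phi t)].

Definition block_perms : {set {perm S}} := [set p : {perm S} | [forall s, beta (p s) == beta s]].

Lemma block_permsP p : reflect (forall s, beta (p s) = beta s) (p \in block_perms).
Proof. by rewrite inE; apply: (iffP forallP) => h s; apply/eqP. Qed.

(** Restriction to the blocks embeds these permutations into a product of symmetric groups. *)
Lemma card_block_perms : (#|block_perms| <= \prod_b #|[set s | beta s == b]| `!)%N.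
Proof.
pose F b : {pred {perm S}} := perm_on [set s | beta s == b].
pose h p := [ffun b => restr_perm [set s | beta s == b] p].
have hI : {in block_perms &, injective h}.
  move=> p q /block_permsP pP /block_permsP qP pq; apply/permP => s.
  have stab (r : {perm S}) : (forall s, beta (r s) = beta s) ->
      r \in astabs [set t | beta t == beta s] (perm_action S).
    move=> rP; apply/astabsP => t; rewrite !inE /= /aperm rP.
    by [].
  have sb : s \in [set t | beta t == beta s] by rewrite inE.
  move/ffunP/(_ (beta s)): pq; rewrite !ffunE => /permP/(_ s).
  by rewrite !restr_permE ?stab.
rewrite -(card_in_imset hI).
apply: (@leq_trans #|(family F : pred {ffun B -> {perm S}})|).
  apply/subset_leq_card/fintype.subsetP => _ /imsetP[p _ ->].
  by apply/familyP => b; rewrite ffunE; exact: restr_perm_on.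
rewrite card_family foldrE big_map enumT; apply/eq_leq/eq_bigr => b _.
by rewrite card_perm.
Qed.

(* A block permutation maximizing [\sum_s rank s * phi (p s)] sorts phi. *)
Lemma block_sort phi : injective phi ->
  exists2 p, p \in block_perms & block_increasing [ffun s => phi (p s)].
Proof.
move=> phiI; pose W p := \sum_s rank s * phi (p s).
have P1 : (1%g : {perm S}) \in block_perms by apply/block_permsP => s; rewrite perm1.
case: (arg_maxnP W P1) => p pP pmax; exists p => //.
apply/andP; split; first by apply/injectiveP => s t; rewrite !ffunE => /phiI /perm_inj.
apply/forallP => s; apply/forallP => t; apply/implyP => /eqP st; apply/implyP => rst.
rewrite !ffunE ltnNge; apply/negP => le.
have ts : t != s by apply: contraTneq rst => ->; rewrite ltnn.
have {}le : (phi (p t) < phi (p s))%N.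
  rewrite ltn_neqAle le andbT; apply: contra ts => /eqP /val_inj /phiI /perm_inj ->.
  by [].
pose q := (tperm s t * p)%g.
have qP : q \in block_perms.
  apply/block_permsP => x; rewrite permM; move/block_permsP: pP => ->.
  by case: tpermP => [->|->|].
have WE r : W r = rank s * phi (r s) + (rank t * phi (r t) +
    \sum_(i | (i != s) && (i != t)) rank i * phi (r i)).
  by rewrite /W (bigD1 s) //= (bigD1 t).
have := pmax q qP; rewrite !WE !permM tpermL tpermR.
have -> : \sum_(i | (i != s) && (i != t)) rank i * phi (q i) =
          \sum_(i | (i != s) && (i != t)) rank i * phi (p i).
  apply: eq_bigr => i /andP[is_ it]; rewrite permM tpermD // eq_sym //.
set X := \sum_(i | _) _.
clear -rst le; move: rst le; move: (phi (p t)) (phi (p s)) (rank s) (rank t) X.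
move=> a b i j X /= ij ab; nia.
Qed.

(** Each injection becomes block increasing after some block permutation, and composing with a fixed
    permutation is injective on maps. *)
Lemma card_block_increasing :
  (n ^_ #|S| <= #|[pred phi | block_increasing phi]| *
     \prod_b #|[set s | beta s == b]| `!)%N.
Proof.
have := card_inj_ffuns S 'I_n; rewrite card_ord => <-.
apply: (@leq_trans (\sum_(p in block_perms) #|[pred phi | block_increasing phi]|)); last first.
  by rewrite sum_nat_const mulnC leq_mul2l card_block_perms orbT.
have H : (#|[set f : {ffun S -> 'I_n} | injectiveb f]| <= \sum_(p in block_perms)
    #|[pred phi : {ffun S -> 'I_n} | block_increasing [ffun s => phi (p s)]]|)%N.
  under eq_bigr => p _ do rewrite -sum1_card big_mkcond.
  rewrite exchange_big -sum1_card big_mkcond /=; apply: leq_sum => phi _.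
  rewrite inE; case: injectiveP => // /block_sort[p pP pi].
  by rewrite (bigD1 p) //= inE pi.
apply: (leq_trans H); apply: leq_sum => p _.
rewrite -(@card_imset _ _ (fun phi => [ffun s => phi (p s)])).
  apply/subset_leq_card/fintype.subsetP => _ /imsetP[phi + ->].
  by rewrite !inE.
move=> phi psi /ffunP E; apply/ffunP => s.
by have := E ((p^-1)%g s); rewrite !ffunE permKV.
Qed.
End BlockIncreasing.

(** * First moment of the number of explorations *)

Section ExpectedExplorers.
Variables (n L : nat) (S : {fset (seq nat)}) (v0 : 'I_n).
Hypothesis tS : trunc_tree L S.
Notation V := 'I_n.
Implicit Types (w : seq (V * V)) (phi : {ffun S -> V}) (s t u : S).

Lemma rcons_cases (v : seq nat) : v = [::] \/ exists p i, v = rcons p i.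
Proof. by case/lastP: v => [|p i]; [left|right; exists p, i]. Qed.

Definition parent (v : seq nat) := take (size v).-1 v.

Lemma parent_rcons v i : parent (rcons v i) = v.
Proof. by rewrite /parent size_rcons -cats1 take_size_cat. Qed.

(** Blocks are the families of siblings, with the root alone in [None]; ranking by the last letter
    turns [block_increasing] into the sibling order of [explores]. *)
Definition block s : option S := if val s == [::] then None else insub (parent (val s)).

Lemma block_rcons s v i : val s = rcons v i -> exists2 u : S, val u = v & block s = Some u.
Proof.
move=> sE; have vS : v \in S by apply: (tree_parent tS (i := i)); rewrite -sE fsvalP.
exists [` vS]%fset => //; rewrite /block sE parent_rcons.
case: eqP => [/(congr1 size)|_]; first by rewrite size_rcons.
by rewrite insubT.
Qed.

Lemma block_SomeP s u : reflect (is_child (val u) (val s)) (block s == Some u).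
Proof.
apply: (iffP eqP) => [E|/is_childP[j sE]]; last first.
  by have [u' uv ->] := block_rcons sE; congr Some; exact: val_inj.
have [sE|[v [i sE]]] := rcons_cases (val s); first by rewrite /block sE eqxx in E.
have [u' u'v] := block_rcons sE; rewrite E => -[->].
by apply/is_childP; exists i; rewrite u'v.
Qed.

Lemma block_NoneP s : (block s == None) = (val s == [::]).
Proof.
have [sE|[v [i sE]]] := rcons_cases (val s); first by rewrite /block sE eqxx.
have [u' u'v ->] := block_rcons sE.
by rewrite sE; case: (v).
Qed.

Lemma card_block_Some u : #|[set s | block s == Some u]| = nchildren S (val u).
Proof.
rewrite cardE -(size_map val) /nchildren; apply: perm_size.
apply: uniq_perm; [by rewrite (map_inj_uniq val_inj) enum_uniq|exact: fset_uniq|].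
move=> v; rewrite !inE; apply/mapP/andP => [[s]|[vS uv]].
  by rewrite mem_enum inE => /block_SomeP sc ->; rewrite fsvalP.
by exists [` vS]%fset => //; rewrite mem_enum inE; exact/block_SomeP.
Qed.

Lemma card_block_None : #|[set s | block s == None]| = 1%N.
Proof.
apply/eqP/cards1P; exists [` tree_root tS]%fset; apply/setP => s.
by rewrite !inE block_NoneP; apply/eqP/eqP => [e|->//]; exact: val_inj.
Qed.

Lemma big_option (R : Type) (idx : R) (op : Monoid.com_law idx) (T : finType) (F : option T -> R) :
  \big[op/idx]_b F b = op (F None) (\big[op/idx]_(x : T) F (Some x)).
Proof.
rewrite (bigD1 None) //=; congr (op _ _).
rewrite (reindex_omap Some id) //=; first by apply: eq_bigl => x; rewrite eqxx.
by case.
Qed.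

Lemma prod_block_fact :
  \prod_b (#|[set s | block s == b]|) `! = \prod_(u : S) (nchildren S (val u)) `!.
Proof.
rewrite big_option /= card_block_None.
rewrite (_ : 1 `! = 1)%N // mul1n.
by apply: eq_bigr => u _; rewrite card_block_Some.
Qed.

Lemma sum_nchildren : (1 + \sum_(u : S) nchildren S (val u))%N = #|` S|.
Proof.
rewrite cardfE -sum1_card [RHS](partition_big block predT) //= [RHS]big_option /=; congr addn.
  by rewrite sum1dep_card card_block_None.
by apply: eq_bigr => u _; rewrite sum1dep_card card_block_Some.
Qed.

Lemma nchildren_leaf v : (L <= size v)%N -> nchildren S v = 0%N.
Proof.
move=> Lv; apply/eqP; rewrite -leqn0 leqNgt -(tree_childE tS).
by apply/negP => /(tree_interior tS); rewrite ltnNge Lv.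
Qed.

Let inc phi := block_increasing block (fun s => last 0%N (val s)) phi.
Let inner : pred S := [pred s | size (val s) < L]%N.

Definition image_inner phi := [set phi s | s in inner].
Definition tree_edges phi :=
  [set [set extend v0 phi (parent (val s)); phi s] | s : S & val s != [::]].
(** Vertices at depth [L] are left out of the forbidden set, since [explores] prescribes nothing
    about their other neighbours. *)
Definition avoiding phi : pred (V * V) :=
  [pred a | (a.1 \notin image_inner phi) && (a.2 \notin image_inner phi)].

Lemma inc_inj phi : inc phi -> injective phi.
Proof. by case/andP => /injectiveP. Qed.

Lemma parentP s : val s != [::] -> exists u i,
  [/\ val s = rcons (val u) i, parent (val s) = val u & inner u].
Proof.
have [->//|[v [i sE]] _] := rcons_cases (val s).
have [u uv _] := block_rcons sE; exists u, i; rewrite sE parent_rcons uv; split=> //.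
by rewrite /inner /= uv; apply: (tree_interior tS (i := i)); rewrite -sE fsvalP.
Qed.

Lemma tree_edges_in phi e : e \in tree_edges phi ->
  exists s u i, [/\ val s = rcons (val u) i, inner u & e = [set phi u; phi s]].
Proof.
move=> /imsetP[s]; rewrite inE => /parentP[u [i [sE pE iu]]] ->.
by exists s, u, i; split=> //; rewrite pE extend_val.
Qed.

Lemma tree_edgesI phi s u i : val s = rcons (val u) i -> [set phi u; phi s] \in tree_edges phi.
Proof.
move=> sE; apply/imsetP; exists s; first by rewrite inE sE; case: (val u).
by rewrite sE parent_rcons extend_val.
Qed.

Lemma rcons_neq (v : seq nat) i : rcons v i <> v.
Proof. by move/(congr1 size); rewrite size_rcons; lia. Qed.

Lemma card_tree_edges phi : inc phi -> #|tree_edges phi| = #|` S|.-1.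
Proof.
move=> /inc_inj phiI; rewrite card_in_imset.
  have := cardsC [set s : S | val s == [::]].
  have -> : [set s : S | val s == [::]] = [set s | block s == None].
    by apply/setP => s; rewrite !inE block_NoneP.
  rewrite card_block_None cardfE => <-; rewrite add1n /=; apply: eq_card => s.
  by rewrite !inE block_NoneP.
move=> s t; rewrite !inE => /parentP[u [i [sE -> _]]] /parentP[u' [j [tE -> _]]].
rewrite !extend_val => /set2_inj [[_ /phiI //]|[/phiI ut /phiI su']].
by exfalso; move: sE tE; rewrite su' ut => -> /(congr1 size); rewrite !size_rcons; lia.
Qed.

Lemma card_avoiding phi : inc phi -> #|avoiding phi| = ((n - #|inner|) ^ 2)%N.
Proof.
move=> /inc_inj phiI; rewrite -(card_imset _ phiI) -/(image_inner phi).
have -> : (n - #|image_inner phi|)%N = #|~: image_inner phi|.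
  by rewrite [RHS]cardsCs finset.setCK card_ord.
rewrite -mulnn -cardsX; apply: eq_card => a.
by rewrite !inE.
Qed.

(** Every arc meeting an inner vertex carries a tree edge and every tree edge occurs, so inner
    neighbourhoods are exactly those of the tree. *)
Lemma uses_once_explorer phi w : inc phi ->
  uses_once (avoiding phi) (tree_edges phi) w -> explorer L v0 (adjw w) phi.
Proof.
move=> ip /uses_onceP[wD Dw]; have phiI := inc_inj ip.
have adj_edge s u i : val s = rcons (val u) i -> adjw w (phi u) (phi s).
  move=> sE; have [a aw aE] := Dw _ (tree_edgesI phi sE).
  have /orP[] : adjw w a.1 a.2 by rewrite /adjw; case: a aw aE => a1 a2 /= ->.
    by case/set2_inj: aE => -[<- <-] h; rewrite /adjw h ?orbT.
  by case/set2_inj: aE => -[<- <-] h; rewrite /adjw h ?orbT.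
apply/asboolP; split.
- move=> u v uS vS; rewrite -[u]/(val [` uS]%fset) -[v]/(val [` vS]%fset) !extend_val.
  by move=> /phiI ->.
- move=> u i j jS ij; have iS : rcons u i \in S.
    by move: jS; rewrite !(tree_childE tS); exact: ltn_trans.
  rewrite -[rcons u i]/(val [` iS]%fset) -[rcons u j]/(val [` jS]%fset) !extend_val.
  have [u1 u1E b1] := @block_rcons [` iS]%fset u i erefl.
  have [u2 u2E b2] := @block_rcons [` jS]%fset u j erefl.
  have /andP[_ /forallP/(_ [` iS]%fset)/forallP/(_ [` jS]%fset)] := ip.
  rewrite b1 b2 (_ : u1 = u2); last by apply: val_inj; rewrite u1E u2E.
  by rewrite eqxx /= !last_rcons ij.
move=> u uS uL y; rewrite -[u]/(val [` uS]%fset) extend_val.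
set s := [` uS]%fset; have is_ : inner s by [].
have sI : phi s \in image_inner phi by apply: imset_f.
split=> [sy|[v vS [uv ->]]].
  have [a aw aE] : exists2 a, a \in w & arc_edge a = [set phi s; y].
    case/orP: sy => h; first by exists (phi s, y).
    by exists (y, phi s) => //; rewrite /arc_edge finset.setUC.
  have : ~~ avoiding phi a.
    have : phi s \in arc_edge a by rewrite aE set21.
    by rewrite !inE negb_and !negbK => /orP[] /eqP <-; rewrite sI ?orbT.
  have := wD _ aw => /orP[->//|+ _]; rewrite aE => /tree_edges_in[t [u' [i [tE _]]]].
  case/set2_inj => -[/phiI E ->].
    exists (val t); first exact: fsvalP.
    by rewrite extend_val tE E; split=> //; exact: nbr_rcons.
  exists (val u'); first exact: fsvalP.
  by rewrite extend_val E tE; split=> //; rewrite nbr_sym nbr_rcons.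
rewrite -[v]/(val [` vS]%fset) extend_val.
case/orP: uv => /is_childP[i E]; first exact: (adj_edge _ _ i).
by rewrite adjw_sym; exact: (adj_edge _ _ i).
Qed.

(** Counts pairs of an increasing map and a sequence meeting the sufficient condition of
    [uses_once_explorer]. The factorials are the sizes of the sibling permutation groups. *)
Lemma sum_nexplorer_ge m :
  (n ^_ #|` S| * (m ^_ (#|` S|.-1) * 2 ^ (#|` S|.-1) *
     ((n - #|inner|) ^ 2) ^ (m - #|` S|.-1)) <=
   (\prod_(u : S) (nchildren S (val u)) `!) *
   \sum_(w : m.-tuple (V * V)) nexplorer L S v0 w)%N.
Proof.
set q := #|` S|.-1; have := card_block_increasing n block (fun s => last 0%N (val s)).
rewrite prod_block_fact -cardfE => h; apply: leq_trans (leq_mul h (leqnn _)) _.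
rewrite mulnAC mulnC leq_mul2l; apply/orP; right.
rewrite -sum_nat_const; under [leqRHS]eq_bigr => w _.
  rewrite /nexplorer -sum1_card big_mkcond.
over.
rewrite [leqRHS]exchange_big [leqLHS]big_mkcond /=; apply: leq_sum => phi _.
rewrite inE -/(inc phi); case: ifP => // ip.
rewrite -(card_avoiding ip) /q -(card_tree_edges ip) -card_uses_once.
- apply: leq_sum => w _; have [uw|//] := boolP (uses_once _ _ _).
  by rewrite inE (uses_once_explorer ip uw).
- move=> e /tree_edges_in[s [u [i [sE _ ->]]]]; rewrite cards2.
  by case: eqP => // /(inc_inj ip) E; case: (@rcons_neq (val u) i); rewrite -sE E.
move=> a /andP[a1 a2]; apply/negP => /tree_edges_in[s [u [i [sE iu aE]]]].
have uI : phi u \in image_inner phi by apply: imset_f.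
have : phi u \in arc_edge a by rewrite aE set21.
by rewrite !inE => /orP[]/eqP E; [move: a1|move: a2]; rewrite -E uI.
Qed.
End ExpectedExplorers.

(** * Frequencies of trees in a uniform planar graph *)

Section PlanarDensity.
Local Open Scope ring_scope.
Variables (R : realType) (n m : nat).
Notation V := 'I_n.

Implicit Types (S : {fset (seq nat)}).

Definition nexplorer_graph L S (v0 : V) (E : {set {set V}}) : nat :=
  #|[pred phi : {ffun S -> V} | explorer L v0 (adj E) phi]|.

Lemma adj_edges (w : seq (V * V)) : is_graph (edges w) -> adj (edges w) =2 adjw w.
Proof.
move=> /forall_inP gw x y; rewrite /adj mem_edges; have [<-|//] := eqVneq x y.
apply/esym/negP; rewrite -mem_edges => /gw; rewrite finset.setUid cards1.
by [].
Qed.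

Lemma nexplorer_edges L S v0 (w : seq (V * V)) : is_graph (edges w) ->
  nexplorer_graph L S v0 (edges w) = nexplorer L S v0 w.
Proof.
move=> gw; apply: eq_card => phi; rewrite !inE /explorer.
congr (`[< _ >]); congr (explores _ _ _ _).
by apply/funext => x; apply/funext => y; rewrite adj_edges.
Qed.

Lemma planar_classP E : E \in planar_class R n m -> is_graph E /\ #|E| = m.
Proof. by rewrite inE => /and3P[gE /eqP]. Qed.

Lemma forest_planar_class (w : m.-tuple (V * V)) :
  forest w -> edges w \in planar_class R n m.
Proof.
move=> fw; have [gw cw] := forest_edges fw; rewrite inE gw cw size_tuple eqxx /=.
by apply/asboolP; exact: forest_planar.
Qed.

Lemma card_planar_labellings :
  #|[pred w : m.-tuple (V * V) | edges w \in planar_class R n m]|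
    = (m`! * 2 ^ m * #|planar_class R n m|)%N.
Proof.
have := @sum_labellings n R m (planar_class R n m) (fun=> 1) planar_classP.
rewrite !sumr_const -natrM => /eqP; rewrite eqr_nat => /eqP <-.
by apply: eq_card.
Qed.

Lemma nforest_le_planar :
  (nforest V m <= m`! * 2 ^ m * #|planar_class R n m|)%N.
Proof.
rewrite -card_planar_labellings -sum1_card [leqRHS]big_mkcond; apply: leq_sum => w _ /=.
by rewrite inE; case: (boolP (forest w)) => // /forest_planar_class ->.
Qed.

(** [conditional_mean_ge] for sequences whose edge set is planar, an event containing all forests,
    followed by division by the common multiplicity m! 2^m. *)
Lemma planar_density_ge L S (v0 : V) (s h : R) : trunc_tree L S ->
  let B := (4 * #|` S| * #|` S| ^ L)%N%:R in
  0 < s -> s * B <= 1 / 2 ->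
  expR (- h) * n%:R ^+ (2 * m) <= (nforest V m)%:R ->
  #|planar_class R n m|%:R *
    (tuple_mean m (fun w => (nexplorer L S v0 w)%:R) - 2 * s * m%:R * B ^+ 2 - h / s)
    <= \sum_(E in planar_class R n m) (nexplorer_graph L S v0 E)%:R.
Proof.
move=> tS B s0 sB nf.
have n0 : (0 < n)%N by case: (n) v0 => // -[].
have T0 : (0 < #|{: V * V}|)%N by rewrite card_prod card_ord muln_gt0 n0.
have TE : #|{: V * V}|%:R ^+ m = n%:R ^+ (2 * m) :> R.
  by rewrite card_prod card_ord natrM -expr2 exprM.
have f0 : (0 < nforest V m)%N.
  by rewrite -(ltr_nat R); apply: lt_le_trans nf; rewrite mulr_gt0 ?expR_gt0 ?exprn_gt0 ?ltr0n.
pose A := [pred w : m.-tuple (V * V) | edges w \in planar_class R n m].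
have fB : lipschitz_entries (fun w : seq (V * V) => (nexplorer L S v0 w)%:R : R) B.
  by move=> w1 a b w2; rewrite -natrD ler_nat; exact: nexplorer_lipschitz.
have A0 : (0 < #|A|)%N by rewrite card_planar_labellings; exact: leq_trans nforest_le_planar.
have Ah : expR (- h) * #|{: V * V}|%:R ^+ m <= #|A|%:R.
  by rewrite TE; apply: le_trans nf _; rewrite ler_nat card_planar_labellings nforest_le_planar.
have := conditional_mean_ge T0 (ler0n _ _) s0 sB fB Ah A0.
rewrite card_planar_labellings natrM -mulrA => H.
have c0 : 0 < (m`! * 2 ^ m)%N%:R :> R by rewrite ltr0n muln_gt0 fact_gt0 expn_gt0.
rewrite -(ler_pM2l c0); apply: le_trans H _.
rewrite -(sum_labellings _ planar_classP); apply: ler_sum => w; rewrite inE => wA.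
by rewrite nexplorer_edges //; case: (planar_classP wA).
Qed.

End PlanarDensity.

(** * Limit of the first moment *)

Section Asymptotics.
Local Open Scope ring_scope.
Local Open Scope classical_set_scope.
Variable R : realType.

Lemma cvg_invn : (fun n : nat => n%:R^-1 : R) @ \oo --> 0.
Proof. by rewrite -(cvg_shiftS (fun n : nat => n%:R^-1 : R)); exact: cvg_harmonic. Qed.

Lemma cvg_natsub (a : nat -> nat) (t l : R) q : 0 <= t ->
  (fun n => t * (a n)%:R / n%:R) @ \oo --> l ->
  (fun n => t * (a n - q)%N%:R / n%:R) @ \oo --> l.
Proof.
move=> t0 al.
apply: (@squeeze_cvgr _ _ _ _ (fun n => t * (a n)%:R / n%:R - t * q%:R * n%:R^-1)
   (fun n => t * (a n)%:R / n%:R)); last exact: al.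
  near=> n; apply/andP; split; last first.
    by rewrite ler_wpM2r ?invr_ge0 // ler_wpM2l // ler_nat leq_subr.
  rewrite -mulrBl -mulrBr ler_wpM2r ?invr_ge0 // ler_wpM2l //.
  by rewrite lerBlDr -natrD ler_nat; lia.
have : (fun n => t * (a n)%:R / n%:R - t * q%:R * n%:R^-1) @ \oo --> (l - t * q%:R * 0 : R).
  by apply: cvgB => //; apply: cvgMl_tmp; exact: cvg_invn.
by rewrite mulr0 subr0.
Unshelve. all: by end_near.
Qed.

(** The scale [t] allows one statement for both falling factorials: [t] = 1 for the vertices and [t]
    = 2 for the edges with their orientations. *)
Lemma cvg_ffact (a : nat -> nat) (t l : R) q : 0 <= t ->
  (fun n => t * (a n)%:R / n%:R) @ \oo --> l ->
  (fun n => (a n ^_ q)%:R * t ^+ q / n%:R ^+ q) @ \oo --> l ^+ q.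
Proof.
move=> t0 al; elim: q => [|q IH].
  rewrite (_ : (fun n => _) = (fun=> 1)); first exact: cvg_cst.
  by apply/funext => n; rewrite ffactn0 !expr0 divr1 mulr1.
rewrite (_ : (fun n => _) = (fun n => (a n ^_ q)%:R * t ^+ q / n%:R ^+ q *
    (t * (a n - q)%N%:R / n%:R))).
  by rewrite exprSr; apply: cvgM => //; exact: cvg_natsub.
by apply/funext => n; rewrite ffactnSr natrM !exprSr invfM; ring.
Qed.

Lemma cvg_avoid (m : nat -> nat) (c : R) (a : nat) :
  (fun n => 2 * (m n)%:R / n%:R) @ \oo --> c ->
  (fun n => expR (- (2 * (m n)%:R / n%:R * (a%:R / (1 - a%:R / n%:R))))) @ \oo
    --> expR (- (c * a%:R)).
Proof.
move=> mc; apply: (cvg_comp _ expR); last exact: continuous_expR.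
apply: cvgN; apply: cvgM => //.
have H : (fun n => 1 - a%:R / n%:R : R) @ \oo --> (1 - a%:R * 0 : R).
  by apply: cvgB; [exact: cvg_cst|apply: cvgMl_tmp; exact: cvg_invn].
rewrite mulr0 subr0 in H.
have := cvgM (cvg_cst (a%:R : R)) (cvgV (oner_neq0 R) H).
by rewrite invr1 mulr1; apply.
Qed.

Lemma avoid_ge (n m a : nat) : (a < n)%N ->
  expR (- (2 * m%:R / n%:R * (a%:R / (1 - a%:R / n%:R)))) <= (1 - a%:R / n%:R) ^+ (2 * m) :> R.
Proof.
move=> an; have n0 : 0 < n%:R :> R by rewrite ltr0n; case: (n) an.
set y : R := a%:R / n%:R.
have y1 : y < 1 by rewrite ltr_pdivrMr // mul1r ltr_nat.
have -> : - (2 * m%:R / n%:R * (a%:R / (1 - y))) = (2 * m)%:R * (- (y / (1 - y))).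
  by rewrite natrM /y; ring.
have y1' : 0 < 1 - y by rewrite subr_gt0.
rewrite expRM_natl; apply: lerXn2r; rewrite ?nnegrE ?expR_ge0 ?(ltW y1') //.
(* 1 / (1 - y) = 1 + y / (1 - y) <= exp (y / (1 - y)) *)
rewrite expRN -[leRHS]invrK lef_pV2 ?posrE ?invr_gt0 ?expR_gt0 //.
apply: le_trans (expR_ge1Dx _); rewrite le_eqVlt; apply/orP; left; apply/eqP.
by field; rewrite gt_eqF.
Qed.

(** The bound of [sum_nexplorer_ge] divided by n * n^(2 m), arranged into convergent factors by k =
    q + 1. The exponential replaces the power (1 - a/n)^(2 (m - q)) that it bounds from below. *)
Definition weight_lower_bound (S : {fset (seq nat)}) L (m n : nat) : R :=
  let k := #|` S| in let q := k.-1 in let a := #|[pred s : S | size (val s) < L]%N| in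
  ((n ^_ k)%:R * 1 ^+ k / n%:R ^+ k) * ((m ^_ q)%:R * 2 ^+ q / n%:R ^+ q) *
  expR (- (2 * m%:R / n%:R * (a%:R / (1 - a%:R / n%:R)))) /
  (\prod_(u : S) (nchildren S (val u)) `!)%N%:R.

Lemma mean_explorers_ge (n m L : nat) S (v0 : 'I_n) : trunc_tree L S ->
  (#|[pred s : S | size (val s) < L]%N| < n)%N ->
  n%:R * weight_lower_bound S L m n <= tuple_mean m (fun w => (nexplorer L S v0 w)%:R).
Proof.
move=> tS an.
have n0 : 0 < n%:R :> R by rewrite ltr0n; case: (n) an.
have k0 : (0 < #|` S|)%N by rewrite cardfs_gt0; apply/fset0Pn; exists [::]; exact: tree_root tS.
rewrite /weight_lower_bound; set k := #|` S| in k0 *; set q := k.-1.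
set a := #|_| in an *; set P := (\prod_u _)%N.
have P0 : 0 < P%:R :> R by rewrite ltr0n prodn_gt0 // => u; exact: fact_gt0.
have y1 : 0 <= 1 - a%:R / n%:R :> R.
  by rewrite subr_ge0 ler_pdivrMr // mul1r ler_nat ltnW.
rewrite /tuple_mean card_prod card_ord ler_pdivlMr ?exprn_gt0 ?ltr0n ?muln_gt0 ?andbb
  -?(ltr_nat R) //.
have := sum_nexplorer_ge v0 tS m; rewrite -/k -/q -/a -/P.
rewrite -(ler_nat R) !natrM natr_sum => H.
rewrite -(ler_pM2l P0); apply: le_trans H.
have [qm|mq] := leqP q m; last by rewrite (ffact_small mq) !(mul0r, mulr0).
have -> : P%:R * (n%:R * ((n ^_ k)%:R * 1 ^+ k / n%:R ^+ k * ((m ^_ q)%:R * 2 ^+ q / n%:R ^+ q) *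
    expR (- (2 * m%:R / n%:R * (a%:R / (1 - a%:R / n%:R)))) / P%:R) * (n%:R * n%:R) ^+ m) =
  (n ^_ k)%:R * ((m ^_ q)%:R * 2 ^+ q *
    (expR (- (2 * m%:R / n%:R * (a%:R / (1 - a%:R / n%:R)))) * (n%:R ^+ 2) ^+ (m - q))) :> R.
  have -> : k = q.+1 by rewrite /q prednK.
  have -> : (n%:R * n%:R) ^+ m = (n%:R ^+ 2) ^+ (m - q) * (n%:R ^+ q * n%:R ^+ q) :> R.
    by rewrite -expr2 -exprD addnn -mul2n (exprM _ 2 q) -exprD subnK.
  rewrite (exprS n%:R q) expr1n; set X := expR _; set Y := (_ ^+ 2) ^+ _.
  by field; rewrite !gt_eqF ?exprn_gt0.
rewrite ler_wpM2l // !natrX natrB ?(ltnW an) // ler_wpM2l ?mulr_ge0 ?exprn_ge0 //.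
have -> : n%:R - a%:R = n%:R * (1 - a%:R / n%:R) :> R by field; rewrite gt_eqF.
set z := 1 - _ / _.
have -> : (n%:R * z) ^+ 2 ^+ (m - q) = n%:R ^+ 2 ^+ (m - q) * z ^+ 2 ^+ (m - q).
  by rewrite -[RHS]exprMn; congr (_ ^+ _); rewrite [LHS]exprMn.
rewrite [leLHS]mulrC; apply: ler_wpM2l; first by rewrite !exprn_ge0 // ltW.
apply: le_trans (avoid_ge m an) _; rewrite -exprM.
have z1 : z <= 1 by rewrite /z gerBl divr_ge0.
by rewrite ler_wiXn2l // leq_mul2l leq_subr.
Qed.

(** In the Poisson product the child counts of interior vertices add up to k - 1, the exponent of c,
    and each interior vertex gives e^(-c). Vertices at depth [L] contribute only 0! = 1. *)
Lemma cvg_weight (m : nat -> nat) (c : R) S L : trunc_tree L S ->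
  (fun n => 2 * (m n)%:R / n%:R) @ \oo --> c ->
  (fun n => weight_lower_bound S L (m n) n) @ \oo --> gw_weight c L S.
Proof.
move=> tS mc.
set a := #|[pred s : S | size (val s) < L]%N|; set k := #|` S|.
have sumd : (\sum_(u : S | (size (val u) < L)%N) nchildren S (val u) = k.-1)%N.
  rewrite /k -(sum_nchildren tS) add1n /= [RHS](bigID (fun u : S => (size (val u) < L)%N)) /=.
  rewrite [X in (_ + X)%N]big1 ?addn0 // => u; rewrite -leqNgt; exact: nchildren_leaf.
have -> : gw_weight c L S = 1 ^+ k * c ^+ k.-1 * expR (- (c * a%:R)) /
    (\prod_(u : S) (nchildren S (val u)) `!)%N%:R.
  rewrite /gw_weight big_seq_fsetE /= /Defs.poisson_pmf !big_split /=.
  rewrite expr1n mul1r [c ^+ _ * _]mulrC; congr (_ * _ * _).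
  - by rewrite prodr_const -expRM_natl mulrN mulrC.
  - by rewrite prodrXr sumd.
  rewrite natr_prod -prodfV [RHS](bigID (fun u : S => (size (val u) < L)%N)) /=.
  rewrite [X in _ * X]big1 ?mulr1 // => u; rewrite -leqNgt => Lu.
  by rewrite (nchildren_leaf tS Lu) fact0 invr1.
rewrite /weight_lower_bound -/a -/k.
apply: cvgM; last exact: cvg_cst.
apply: cvgM; last exact: cvg_avoid.
apply: cvgM; apply: cvg_ffact => //.
apply: cvg_near_cst; near=> n.
by rewrite mul1r divff // pnatr_eq0 -lt0n; near: n; exact: nbhs_infty_gt.
Unshelve. all: by end_near.
Qed.
End Asymptotics.

Section TreeDensity.
Local Open Scope ring_scope.
Local Open Scope classical_set_scope.
Variable R : realType.

Lemma tree_density (m : nat -> nat) (c : R) S L (eps : R) : trunc_tree L S -> c <= 1 ->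
  (fun n => 2 * (m n)%:R / n%:R) @ \oo --> c -> 0 < eps ->
  \forall n \near \oo, forall v0 : 'I_n, (0 < #|planar_class R n (m n)|)%N /\
    (gw_weight c L S - eps) * (#|planar_class R n (m n)| * n)%N%:R <=
      \sum_(E in planar_class R n (m n)) (nexplorer_graph L S v0 E)%:R.
Proof.
move=> tS c1 mc e0.
have [B BE] : exists B : R, B = (4 * #|` S| * #|` S| ^ L)%N%:R by eexists.
have B0 : 0 < B.
  have k0 : (0 < #|` S|)%N by rewrite cardfs_gt0; apply/fset0Pn; exists [::]; exact: tree_root tS.
  by rewrite BE ltr0n !muln_gt0 k0 expn_gt0 k0.
(* The loss eps splits into eps/2 for the convergence of the weight and eps/4 for each of 2 s m B^2
   / n, where m <= n, and h / (s n). *)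
pose s := Num.min (1 / (2 * B)) (eps / (8 * B ^+ 2)).
have s0 : 0 < s by rewrite lt_min !divr_gt0 // ?mulr_gt0 ?exprn_gt0.
have sB : s * B <= 1 / 2.
  apply: (@le_trans _ _ (1 / (2 * B) * B)); first by rewrite ler_pM2r // ge_min lexx.
  by rewrite le_eqVlt; apply/orP; left; apply/eqP; field; rewrite gt_eqF.
have sB2 : 2 * s * B ^+ 2 <= eps / 4.
  apply: (@le_trans _ _ (2 * (eps / (8 * B ^+ 2)) * B ^+ 2)).
    by rewrite ler_pM2r ?exprn_gt0 // ler_pM2l // ge_min lexx orbT.
  by rewrite le_eqVlt; apply/orP; left; apply/eqP; field; rewrite gt_eqF.
(* With h = eta n, the term h / s is exactly eps n / 4. *)
pose eta := s * eps / 4.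
have eta0 : 0 < eta by rewrite divr_gt0 // mulr_gt0.
(* Makes the linear loss 4 delta n of [nforest_ge] at most eta n / 2; large n absorbs 4 / delta + 4
   in the other half. *)
pose delta := Num.min (1 / 3) (eta / 8).
have d0 : 0 < delta by rewrite lt_min; apply/andP; split; apply: divr_gt0.
have d3 : delta <= 1 / 3 by rewrite ge_min lexx.
have d8 : delta <= eta / 8 by rewrite ge_min lexx orbT.
near=> n => v0.
have n7 : 7 <= n%:R :> R by near: n; exact: nbhs_infty_ger.
have nd : 4 / delta ^+ 2 <= n%:R by near: n; exact: nbhs_infty_ger.
have ne : (4 / delta + 4) / (eta / 2) <= n%:R by near: n; exact: nbhs_infty_ger.
have an : (#|[pred s : S | size (val s) < L]%N| < n)%N by near: n; exact: nbhs_infty_gt.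
have n0 : 0 < n%:R :> R by lra.
have mn : 2 * (m n)%:R <= (1 + delta) * n%:R.
  rewrite -ler_pdivrMr // ltW //; near: n; apply: (cvgr_lt _ mc); lra.
have wn : gw_weight c L S - eps / 2 < weight_lower_bound R S L (m n) n.
  by near: n; apply: (cvgr_gt _ (cvg_weight tS mc)); rewrite ltrBlDr ltrDl divr_gt0.
have dn : delta * n%:R <= 1 / 3 * n%:R by rewrite ler_pM2r.
have m1 : (m n)%:R <= n%:R :> R by lra.
have nf : expR (- (eta * n%:R)) * n%:R ^+ (2 * m n) <= (nforest 'I_n (m n))%:R.
  have := @nforest_ge R 'I_n delta (m n); rewrite card_ord d0 d3 => /(_ erefl n7 nd mn).
  apply: le_trans; rewrite ler_pM2r ?exprn_gt0 // ler_expR lerN2.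
  have e2 : 0 < eta / 2 by apply: divr_gt0.
  move: ne; rewrite ler_pdivrMr // => ne.
  have : delta * n%:R <= eta / 8 * n%:R by rewrite ler_pM2r.
  lra.
have A0 : (0 < #|planar_class R n (m n)|)%N.
  have : (0 < nforest 'I_n (m n))%N.
    by rewrite -(ltr_nat R); apply: lt_le_trans nf; rewrite mulr_gt0 ?expR_gt0 ?exprn_gt0.
  by move/leq_trans/(_ (nforest_le_planar R n (m n))); rewrite muln_gt0 => /andP[].
split=> //.
have := planar_density_ge v0 tS s0; rewrite -BE => /(_ _ _ sB nf); apply: le_trans.
rewrite natrM mulrCA ler_pM2l ?ltr0n //.
have := mean_explorers_ge R (m n) v0 tS an.
have : n%:R * (gw_weight c L S - eps / 2) <= n%:R * weight_lower_bound R S L (m n) n.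
  by rewrite ler_pM2l // ltW.
have : 2 * s * (m n)%:R * B ^+ 2 <= eps / 4 * n%:R.
  rewrite mulrAC; apply: ler_pM => //; rewrite ?mulr_ge0 ?exprn_ge0 // ltW //.
have : eta * n%:R / s = eps / 4 * n%:R by rewrite /eta; field; rewrite gt_eqF.
set t1 := eta * _ / s; set t2 := 2 * s * _ * _; set t3 := tuple_mean _ _.
move: (weight_lower_bound _ _ _ _ _) => W ->; lra.
Unshelve. all: by end_near.
Qed.
End TreeDensity.

(** * Total mass of the truncated Galton-Watson tree *)

Section TreeExtension.
Variables (l D : nat) (S0 : {fset (seq nat)}).
Hypothesis tS0 : trunc_tree l S0.
Implicit Types (u v : seq nat).

Definition boundary := [fset u in S0 | size u == l]%fset.

Lemma boundaryP u : (u \in boundary) = (u \in S0) && (size u == l).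
Proof. by rewrite !inE. Qed.

Implicit Types (g : {ffun boundary -> 'I_D}).

Definition extension g : {fset (seq nat)} :=
  seq_fset tt (enum_fset S0 ++
    [seq rcons (val p.1) (nat_of_ord p.2) |
       p <- enum {: boundary * 'I_D} & (nat_of_ord p.2 < g p.1)%N]).

Lemma in_extension g u : u \in extension g <->
  u \in S0 \/ exists b : boundary, exists2 i, (i < g b)%N & u = rcons (val b) i.
Proof.
rewrite seq_fsetE mem_cat; split=> [/orP[uS|/mapP[[b i]]]|[uS|[b [i ig ->]]]].
- by left.
- by rewrite mem_filter => /andP[ig _] ->; right; exists b, i.
- by apply/orP; left.
apply/orP; right; apply/mapP.
have iD : (i < D)%N by exact: ltn_trans (ltn_ord (g b)).
by exists (b, Ordinal iD) => //; rewrite mem_filter mem_enum ig.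
Qed.

Lemma boundary_val (b : boundary) : val b \in S0 /\ size (val b) = l.
Proof. by have := fsvalP b; rewrite boundaryP => /andP[? /eqP]. Qed.

Lemma extension_low g u : (size u <= l)%N -> (u \in extension g) = (u \in S0).
Proof.
move=> ul; apply/idP/idP => [/in_extension[//|[b [i _ uE]]]|uS].
  by move: ul; rewrite uE size_rcons (proj2 (boundary_val b)) ltnn.
by apply/in_extension; left.
Qed.

Lemma extension_tree g : trunc_tree l.+1 (extension g).
Proof.
split; first by apply/in_extension; left; exact: tree_root tS0.
split=> [u i|u].
  move=> /in_extension[uS|[b [j jg /rcons_inj[-> ->]]]].
    split=> [|j ji]; apply/in_extension; left; first exact: (tree_parent tS0 uS).
    by move: uS; rewrite !(tree_childE tS0); exact: ltn_trans.
  split=> [|k kj]; apply/in_extension; first by left; case: (boundary_val b).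
  by right; exists b, k => //; exact: ltn_trans jg.
move=> /in_extension[/(tree_size tS0)/leqW //|[b [j _ ->]]].
by rewrite size_rcons (proj2 (boundary_val b)).
Qed.

Lemma truncate_extension g : truncate l (extension g) = S0.
Proof.
apply/fsetP => u; rewrite in_truncate; apply/andP/idP => [[+ ul]|uS].
  by rewrite extension_low.
by have ul := tree_size tS0 uS; rewrite extension_low.
Qed.

Lemma nchildren_ext (S S' : {fset (seq nat)}) L L' u u' : trunc_tree L S -> trunc_tree L' S' ->
  (forall i, (rcons u i \in S) = (rcons u' i \in S')) -> nchildren S u = nchildren S' u'.
Proof.
move=> tS tS' E; have {}E i : (i < nchildren S u)%N = (i < nchildren S' u')%N.
  by rewrite -(tree_childE tS) -(tree_childE tS').
by apply/eqP; rewrite eqn_leq leqNgt E ltnn leqNgt -E ltnn.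
Qed.

Lemma nchildren_low g u : (size u < l)%N -> nchildren (extension g) u = nchildren S0 u.
Proof.
move=> ul; apply: (nchildren_ext (extension_tree g) tS0) => i.
by rewrite extension_low // size_rcons.
Qed.

Lemma nchildren_boundary g (b : boundary) : nchildren (extension g) (val b) = g b.
Proof.
have E i : (i < nchildren (extension g) (val b))%N = (i < g b)%N.
  rewrite -(tree_childE (extension_tree g)); apply/idP/idP => [/in_extension[iS|]|ig].
  - have := tree_interior tS0 iS; by rewrite (proj2 (boundary_val b)) ltnn.
  - by move=> [b' [j jg /rcons_inj[/val_inj -> ->]]].
  by apply/in_extension; right; exists b, i.
by apply/eqP; rewrite eqn_leq leqNgt E ltnn leqNgt -E ltnn.
Qed.

Lemma extension_inj : injective extension.
Proof.
move=> g g' E; apply/ffunP => b; apply: val_inj.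
by rewrite /= -!nchildren_boundary E.
Qed.

Local Open Scope ring_scope.
Variables (R : realType) (c : R).

(** Vertices at depth [l] become interior, so each adds one Poisson factor, while the factors above
    depth [l] are unchanged. *)
Lemma gw_weight_extension g : gw_weight c l.+1 (extension g) =
  gw_weight c l S0 * \prod_b Defs.poisson_pmf c (g b).
Proof.
rewrite /gw_weight -big_filter.
have : perm_eq [seq u <- extension g | (size u < l.+1)%N] S0.
  apply: uniq_perm; rewrite ?filter_uniq ?fset_uniq // => u.
  rewrite mem_filter ltnS; apply/andP/idP => [[ul]|uS]; first by rewrite extension_low.
  by have ul := tree_size tS0 uS; rewrite extension_low.
move/(perm_big _) ->; rewrite (bigID (fun u => (size u < l)%N)) /=; congr (_ * _).
  by apply: eq_bigr => u ul; rewrite nchildren_low.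
rewrite -big_filter.
have : perm_eq [seq u <- S0 | ~~ (size u < l)%N] boundary.
  apply: uniq_perm; rewrite ?filter_uniq ?fset_uniq // => u.
  rewrite mem_filter boundaryP -leqNgt andbC; have [uS|//] := boolP (u \in S0).
  by rewrite /= eqn_leq (tree_size tS0 uS).
move/(perm_big _) ->; rewrite big_seq_fsetE /=.
by apply: eq_bigr => b _; rewrite nchildren_boundary.
Qed.

Lemma sum_gw_weight_extension : \sum_g gw_weight c l.+1 (extension g) =
  gw_weight c l S0 * (\sum_(d < D) Defs.poisson_pmf c d) ^+ #|{: boundary}|.
Proof.
under eq_bigr => g _ do rewrite gw_weight_extension.
rewrite -mulr_sumr; congr (_ * _); rewrite -prodr_const.
by rewrite (bigA_distr_bigA (fun _ (d : 'I_D) => Defs.poisson_pmf c d)).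
Qed.
End TreeExtension.

Section TotalMass.
Local Open Scope ring_scope.
Local Open Scope classical_set_scope.
Variables (R : realType) (c : R).
Hypothesis c0 : 0 <= c.
Implicit Types (S : {fset (seq nat)}) (TT : seq {fset (seq nat)}).

Lemma poisson_pmf_ge0 j : 0 <= Defs.poisson_pmf c j.
Proof. by rewrite /Defs.poisson_pmf divr_ge0 // mulr_ge0 ?expR_ge0 ?exprn_ge0. Qed.

Lemma gw_weight_ge0 l S : 0 <= gw_weight c l S.
Proof. by apply: prodr_ge0 => u _; exact: poisson_pmf_ge0. Qed.

Lemma cvg_sum_poisson : (fun D => \sum_(d < D) Defs.poisson_pmf c d) @ \oo --> (1 : R).
Proof.
have -> : (fun D => \sum_(d < D) Defs.poisson_pmf c d) =
    (fun D => expR (- c) * series (exp_coeff c) D).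
  apply/funext => D; rewrite /series /= big_mkord mulr_sumr; apply: eq_bigr => d _.
  by rewrite /Defs.poisson_pmf /exp_coeff /= mulrA.
rewrite -(expR0 R) -(addNr c) expRD; apply: cvgMl_tmp.
exact: is_cvg_series_exp_coeff.
Qed.

Lemma extension_mass l S0 (eps : R) : trunc_tree l S0 -> 0 < eps ->
  exists TT, [/\ uniq TT,
    (forall S, S \in TT -> trunc_tree l.+1 S /\ truncate l S = S0) &
    (1 - eps) * gw_weight c l S0 <= \sum_(S <- TT) gw_weight c l.+1 S].
Proof.
move=> tS0 e0.
have [D hD] : exists D, 1 - eps <= (\sum_(d < D) Defs.poisson_pmf c d) ^+ #|{: boundary l S0}|.
  have lim : (fun D => (\sum_(d < D) Defs.poisson_pmf c d) ^+ #|{: boundary l S0}|) @ \oo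
      --> (1 ^+ #|{: boundary l S0}| : R).
    exact: (cvg_comp _ _ cvg_sum_poisson (@exprn_continuous R _ 1)).
  rewrite expr1n in lim.
  have lt1 : 1 - eps < 1 by rewrite ltrBlDr ltrDl.
  have [N _ /(_ N (leqnn N)) H] := cvgr_gt _ lim _ lt1.
  by exists N; exact: ltW.
exists [seq @extension l D S0 g | g : {ffun boundary l S0 -> 'I_D}]; split.
- by rewrite map_inj_uniq ?enum_uniq //; exact: extension_inj.
- move=> _ /mapP[g _ ->]; split; first exact: extension_tree.
  exact: truncate_extension.
rewrite big_map big_enum /= sum_gw_weight_extension // mulrC ler_wpM2l //.
exact: gw_weight_ge0.
Qed.

(** Extensions of different trees differ because truncation recovers the tree. The bound is uniform
    in [P], so the same list keeps the mass of the trees of a given type and of the others. *)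
Lemma extension_mass_seq l TT0 (eps : R) : uniq TT0 ->
  (forall S, S \in TT0 -> trunc_tree l S) -> 0 < eps ->
  exists TT, [/\ uniq TT,
    (forall S, S \in TT -> trunc_tree l.+1 S /\ truncate l S \in TT0) &
    forall P : pred {fset (seq nat)},
      (1 - eps) * \sum_(S <- TT0 | P S) gw_weight c l S
        <= \sum_(S <- TT | P (truncate l S)) gw_weight c l.+1 S].
Proof.
move=> + + e0; elim: TT0 => [|S0 TT0 IH] /=.
  by move=> _ _; exists [::]; split=> // P; rewrite !big_nil mulr0.
move=> /andP[S0n uT] tT.
have [|TT [uTT TTP TTs]] := IH uT; first by move=> S ST; apply: tT; rewrite inE ST orbT.
have [|T1 [uT1 T1P T1s]] := @extension_mass l S0 eps _ e0; first by apply: tT; rewrite mem_head.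
exists (T1 ++ TT); split.
- rewrite cat_uniq uT1 uTT andbT; apply/hasPn => S /TTP[_ ST]; apply/negP => /T1P[_ SE].
  by rewrite -SE ST in S0n.
- move=> S; rewrite mem_cat => /orP[/T1P[tS ->]|/TTP[tS h]]; first by rewrite mem_head.
  by rewrite inE h orbT.
move=> P; rewrite big_cons big_cat /=.
have -> : \sum_(S <- T1 | P (truncate l S)) gw_weight c l.+1 S =
    if P S0 then \sum_(S <- T1) gw_weight c l.+1 S else 0.
  rewrite big_seq_cond; case: ifP => PS0.
    rewrite [RHS]big_seq; apply: eq_bigl => S; have [/T1P[_ ->]|//] := boolP (S \in T1).
    by rewrite PS0.
  by rewrite big_pred0 // => S; have [/T1P[_ ->]|//] := boolP (S \in T1).
case: ifP => PS0; last by rewrite add0r.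
by rewrite mulrDr lerD.
Qed.

(** [gw_weight] is only a product formula; that it has full mass on finite trees is proved level by
    level, with (1 - eps/2)^2 >= 1 - eps. *)
Lemma gw_total_mass l (eps : R) : 0 < eps -> exists TT, [/\ uniq TT,
  (forall S, S \in TT -> trunc_tree l S) & 1 - eps <= \sum_(S <- TT) gw_weight c l S].
Proof.
elim: l eps => [|l IH] eps e0.
  exists [:: [fset [::]]%fset]; split=> //.
    move=> S; rewrite inE => /eqP ->; split; first by rewrite !inE.
    by split=> [u i|u]; rewrite !inE; [case: u|move/eqP->].
  rewrite big_seq1 /gw_weight big_pred0 // lerBlDr lerDl ltW //.
have e2 : 0 < eps / 2 by apply: divr_gt0.
have [TT0 [u0 t0 s0]] := IH _ e2.
have [TT [uT tT sT]] := extension_mass_seq u0 t0 e2.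
exists TT; split=> //; first by move=> S /tT[].
have [e1|e1] := leP eps 1; last first.
  by apply: (@le_trans _ _ 0); [lra|apply: sumr_ge0 => S _; exact: gw_weight_ge0].
apply: le_trans (sT predT).
by apply: (@le_trans _ _ ((1 - eps / 2) * (1 - eps / 2))); [nra|rewrite ler_wpM2l //; lra].
Qed.
End TotalMass.

(** * The local limit *)

Section LocalLimit.
Local Open Scope ring_scope.
Local Open Scope classical_set_scope.
Variables (R : realType) (m : nat -> nat) (c : R).
Hypotheses (c01 : 0 <= c <= 1) (mc : (fun n => 2 * (m n)%:R / n%:R) @ \oo --> c).
Variables (k : nat) (H : {set {set 'I_k}}) (rH : 'I_k) (l : nat).
Implicit Types (S : {fset (seq nat)}) (TT : seq {fset (seq nat)}).

Definition iso_type S : bool := `[< tree_iso S H rH >].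

Definition nballs n b : nat := #|[set p : {set {set 'I_n}} * 'I_n |
  (p.1 \in planar_class R n (m n)) && (ball_iso p.1 p.2 l H rH == b)]%SET|.

Lemma sum_seq_le1 (T : eqType) (s : seq T) (P : pred T) (f : T -> nat) : uniq s ->
  (forall x, x \in s -> P x -> f x <= 1)%N ->
  (forall x y, x \in s -> y \in s -> P x -> P y -> (0 < f x)%N -> (0 < f y)%N -> x = y) ->
  (\sum_(x <- s | P x) f x <= 1)%N.
Proof.
elim: s => [|x s IH] /=; first by rewrite big_nil.
move=> /andP[xs us] f1 fu; rewrite big_cons.
have {}IH : (\sum_(x <- s | P x) f x <= 1)%N.
  apply: IH => // [y ys|y z ys zs]; first by apply: f1; rewrite inE ys orbT.
  by apply: fu; rewrite inE ?ys ?zs orbT.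
case: ifP => // Px; have [fx|fx] := posnP (f x); first by rewrite fx add0n.
rewrite big_seq_cond big1 ?addn0; first by rewrite f1 ?mem_head.
move=> y /andP[ys Py]; apply/eqP; rewrite -leqn0 leqNgt; apply/negP => fy.
have xy : x = y by apply: fu; rewrite ?mem_head // inE ys orbT.
by rewrite xy ys in xs.
Qed.

(** Each root admits at most one pair of a tree and an exploration, and the truncated tree decides
    whether its ball is isomorphic to [H]. *)
Lemma sum_nexplorer_le_balls n E (v0 : 'I_n) TT b : uniq TT ->
  (forall S, S \in TT -> trunc_tree l.+1 S) ->
  (\sum_(S <- TT | iso_type (truncate l S) == b) nexplorer_graph l.+1 S v0 E
    <= #|[set r | ball_iso E r l H rH == b]%SET|)%N.
Proof.
move=> uT tT.
pose cnt S r := #|[pred phi : {ffun S -> 'I_n} |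
  explorer l.+1 v0 (adj E) phi && (extend v0 phi [::] == r)]|.
have -> : (\sum_(S <- TT | iso_type (truncate l S) == b) nexplorer_graph l.+1 S v0 E =
    \sum_r \sum_(S <- TT | iso_type (truncate l S) == b) cnt S r)%N.
  rewrite exchange_big; apply: eq_bigr => S _ /=.
  rewrite /nexplorer_graph -sum1_card (partition_big (fun phi => extend v0 phi [::]) predT) //=.
  by apply: eq_bigr => r _; rewrite /cnt -sum1_card.
rewrite -sum1dep_card [leqRHS]big_mkcond; apply: leq_sum => r _ /=.
have typ S : S \in TT -> (0 < cnt S r)%N ->
    exists2 f, explores S l.+1 (adj E) f & f [::] = r.
  move=> ST /card_gt0P[phi]; rewrite inE => /andP[/asboolP h /eqP hr].
  by exists (extend v0 phi).
have typb S : S \in TT -> (0 < cnt S r)%N -> ball_iso E r l H rH = iso_type (truncate l S).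
  move=> ST /(typ _ ST)[f ef <-]; apply/idP/asboolP => h.
    exact/(ball_iso_explores (tT _ ST) ef).
  exact/(ball_iso_explores (tT _ ST) ef).
case: ifP => rb.
  apply: sum_seq_le1 => // [S ST _|S S' ST ST' _ _ /(typ _ ST)[f ef fr] /(typ _ ST')[f' ef' fr']].
    apply/card_le1_eqP => phi psi; rewrite !inE => /andP[h /eqP hr] /andP[h' /eqP hr'].
    by apply: (explorer_inj (tT _ ST) h' h); rewrite hr hr'.
  by have [] := explores_unique (tT _ ST) (tT _ ST') ef ef' (etrans fr (esym fr')).
rewrite big_seq_cond big1 // => S /andP[ST Sb]; apply/eqP; rewrite -leqn0 leqNgt.
by apply/negP => /(typb _ ST) E0; rewrite E0 Sb in rb.
Qed.

Lemma nballsE n b : nballs n b =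
  (\sum_(E in planar_class R n (m n)) #|[set r | ball_iso E r l H rH == b]%SET|)%N.
Proof.
rewrite /nballs -sum1dep_card.
rewrite -(pair_big_dep (fun E => E \in planar_class R n (m n))
  (fun E r => ball_iso E r l H rH == b) (fun _ _ => 1%N)) /=.
by apply: eq_bigr => E _; rewrite sum1dep_card.
Qed.

Lemma nballs_split n : (nballs n true + nballs n false)%N = (#|planar_class R n (m n)| * n)%N.
Proof.
rewrite !nballsE -big_split /= -sum_nat_const; apply: eq_bigr => E _.
rewrite -[RHS](card_ord n) -(cardsC [set r | ball_iso E r l H rH == true]%SET); congr addn.
by apply: eq_card => r; rewrite !inE; case: (ball_iso _ _ _ _ _).
Qed.

Lemma near_all_seq (T : eqType) (s : seq T) (P : T -> nat -> Prop) :
  (forall x, x \in s -> \forall n \near \oo, P x n) ->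
  \forall n \near \oo, forall x, x \in s -> P x n.
Proof.
elim: s => [|x s IH] h; first by near=> n.
have h1 := h x (mem_head _ _).
have h2 : \forall n \near \oo, forall y, y \in s -> P y n.
  by apply: IH => y ys; apply: h; rewrite inE ys orbT.
near=> n => y; rewrite inE => /predU1P[->|ys]; first by near: n.
by move: y ys; near: n.
Unshelve. all: by end_near.
Qed.

Lemma balls_density_ge TT b (eps : R) : uniq TT ->
  (forall S, S \in TT -> trunc_tree l S) -> 0 < eps ->
  \forall n \near \oo, (0 < #|planar_class R n (m n)| * n)%N /\
    \sum_(S <- TT | iso_type S == b) gw_weight c l S - eps <=
      (nballs n b)%:R / (#|planar_class R n (m n)| * n)%N%:R.
Proof.
move=> uT tT e0; have [c0 c1] := andP c01.
pose W := \sum_(S <- TT | iso_type S == b) gw_weight c l S.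
have W0 : 0 <= W by apply: sumr_ge0 => S _; exact: gw_weight_ge0.
(* Half of eps pays for the mass lost in lifting to depth [l.+1], the other half, through [e2], for
   the errors of the finitely many lifted trees. *)
pose e1 := eps / 2 / (1 + W).
have e10 : 0 < e1 by rewrite !divr_gt0 // ltr_pwDl.
have [TT' [uT' tT' sT']] := extension_mass_seq c0 uT tT e10.
pose e2 := eps / 2 / (size TT').+1%:R.
have e20 : 0 < e2 by rewrite !divr_gt0.
(* The one-vertex tree ensures that the planar class is nonempty even when [TT'] is empty. *)
have t0 : trunc_tree 0 [fset [::]]%fset.
  split; first by rewrite !inE.
  by split=> [u i|u]; rewrite !inE; [case: u|move/eqP->].
have dens0 := tree_density t0 c1 mc e20.
have dens := near_all_seq (fun S ST => tree_density (proj1 (tT' S ST)) c1 mc e20).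
near=> n.
have n0 : (0 < n)%N by near: n; exact: nbhs_infty_gt.
have densn : forall S, S \in TT' -> forall v0 : 'I_n, (0 < #|planar_class R n (m n)|)%N /\
    (gw_weight c l.+1 S - e2) * (#|planar_class R n (m n)| * n)%N%:R <=
      \sum_(E in planar_class R n (m n)) (nexplorer_graph l.+1 S v0 E)%:R.
  by near: n; exact: dens.
have densn0 : forall v0 : 'I_n, (0 < #|planar_class R n (m n)|)%N /\
    (gw_weight c 0 [fset [::]]%fset - e2) * (#|planar_class R n (m n)| * n)%N%:R <=
      \sum_(E in planar_class R n (m n)) (nexplorer_graph 0 [fset [::]]%fset v0 E)%:R.
  by near: n; exact: dens0.
have [A0 _] := densn0 (Ordinal n0).
have An0 : (0 < #|planar_class R n (m n)| * n)%N by rewrite muln_gt0 A0.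
split=> //; rewrite ler_pdivlMr ?ltr0n //.
pose v0 := Ordinal n0; set N := (_ * n)%N%:R; have N0 : 0 <= N by rewrite /N.
apply: (@le_trans _ _ (\sum_(S <- TT' | iso_type (truncate l S) == b)
    (gw_weight c l.+1 S - e2) * N)).
  rewrite -mulr_suml ler_wpM2r // sumrB.
  have h1 := sT' (fun S => iso_type S == b).
  have h2 : \sum_(S <- TT' | iso_type (truncate l S) == b) e2 <= eps / 2.
    apply: (@le_trans _ _ (\sum_(S <- TT') e2)).
      rewrite [leRHS](bigID (fun S => iso_type (truncate l S) == b)) /= lerDl.
      by rewrite sumr_ge0 // => S _; exact: ltW.
    rewrite big_const_seq count_predT iter_addr_0 -[_ *+ size _]mulr_natr /e2 mulrAC ler_pdivrMr //.
    by rewrite ler_pM2l ?divr_gt0 // ler_nat.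
  have h3 : e1 * W <= eps / 2.
    rewrite /e1 mulrAC ler_pdivrMr ?ltr_pwDl // ler_pM2l ?divr_gt0 //.
    by rewrite lerDr.
  by move: h1 h2 h3; rewrite -/W; set X := \sum_(S <- TT' | _) gw_weight _ _ _; lra.
apply: (@le_trans _ _ (\sum_(S <- TT' | iso_type (truncate l S) == b)
    \sum_(E in planar_class R n (m n)) (nexplorer_graph l.+1 S v0 E)%:R)).
  rewrite big_seq_cond [leRHS]big_seq_cond; apply: ler_sum => S /andP[ST _].
  by case: (densn S ST v0).
rewrite exchange_big nballsE natr_sum; apply: ler_sum => E _ /=.
rewrite -natr_sum ler_nat; apply: sum_nexplorer_le_balls => // S /tT'[] //.
Unshelve. all: by end_near.
Qed.

(** Up to any eps, the weights are lower bounds for frequencies in planar graphs, and frequencies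
    are at most 1. *)
Lemma sum_iso_le TT : uniq TT -> (forall S, S \in TT -> trunc_tree l S) ->
  \sum_(S <- TT | iso_type S) gw_weight c l S <= 1.
Proof.
move=> uT tT; apply/ler_addgt0Pr => eps e0.
have [N _ /(_ N (leqnn N))[A0]] := balls_density_ge true uT tT e0.
rewrite lerBlDr => h.
have -> : \sum_(S <- TT | iso_type S) gw_weight c l S =
    \sum_(S <- TT | iso_type S == true) gw_weight c l S.
  by apply: eq_bigl => S; rewrite eqb_id.
apply: le_trans h _; rewrite lerD2r ler_pdivrMr ?ltr0n // mul1r ler_nat -nballs_split.
exact: leq_addr.
Qed.

Lemma gw_ball_prob_ge TT : uniq TT -> (forall S, S \in TT -> trunc_tree l S) ->
  ((\sum_(S <- TT | iso_type S) gw_weight c l S)%:E <= gw_ball_prob c l H rH)%E.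
Proof.
move=> uT tT; apply: esum_ge; exists [set` [seq S <- TT | iso_type S]].
  split; first exact: finite_seq.
  by move=> S /=; rewrite mem_filter => /andP[/asboolP iS /tT].
by rewrite -fsbig_seq ?filter_uniq // sumEFin big_filter.
Qed.

Lemma gw_ball_prob_fsets A : fsets [set S | trunc_tree l S /\ tree_iso S H rH] A ->
  exists TT, [/\ uniq TT, (forall S, S \in TT -> trunc_tree l S) &
    \sum_(S \in A) (gw_weight c l S)%:E =
    (\sum_(S <- TT | iso_type S) gw_weight c l S)%:E]%E.
Proof.
move=> [fA AP]; exists (fset_set A); split; first exact: fset_uniq.
  by move=> S; rewrite in_fset_set // inE => /AP[].
rewrite fsbig_finite //= sumEFin; congr EFin; rewrite big_seq [RHS]big_seq_cond.
apply: eq_bigl => S; have [|//] := boolP (S \in _).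
by rewrite in_fset_set // inE => /AP[_ /asboolP]; rewrite -/(iso_type S) => ->.
Qed.

Lemma gw_ball_prob_fin : gw_ball_prob c l H rH \is a fin_num.
Proof.
rewrite fin_numE; apply/andP; split.
  apply/eqP => E.
  have : (0%:E <= gw_ball_prob c l H rH)%E.
    by apply: le_trans (@gw_ball_prob_ge [::] erefl _) => //; rewrite big_nil.
  by rewrite E.
have : (gw_ball_prob c l H rH <= 1%:E)%E.
  apply: ge_ereal_sup => _ [A /gw_ball_prob_fsets[TT [uT tT ->]] <-].
  by rewrite lee_fin sum_iso_le.
by apply: contraTneq => ->.
Qed.

(** [TT1] nearly attains the supremum defining the limit and gives the lower bound. [TT2] has mass
    at least 1 - eps/2, of which at most [p] is of the right type, so the frequency of the other
    balls is at least 1 - [p] - eps. *)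
Lemma local_limit : (fun n => pr_ball R n (m n) l H rH) @ \oo --> fine (gw_ball_prob c l H rH).
Proof.
set p := fine _; have pE : p%:E = gw_ball_prob c l H rH by rewrite fineK // gw_ball_prob_fin.
have [c0 _] := andP c01.
have prE n : pr_ball R n (m n) l H rH = (nballs n true)%:R / (#|planar_class R n (m n)| * n)%N%:R.
  rewrite /pr_ball; congr (_%:R / _); apply: eq_card => q; rewrite !inE.
  by rewrite eqb_id.
apply/cvgrPdist_le => eps e0.
have e2 : 0 < eps / 2 by apply: divr_gt0.
have [_ [A /gw_ball_prob_fsets[TT1 [u1 t1 ->]] <-]] :=
  ub_ereal_sup_adherent e2 gw_ball_prob_fin.
rewrite -/(esum _ _) -/(gw_ball_prob c l H rH) -pE -EFinB lte_fin => s1.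
have [TT2 [u2 t2 s2]] := gw_total_mass c0 l e2.
have d1 := balls_density_ge true u1 t1 e2.
have d2 := balls_density_ge false u2 t2 e2.
near=> n.
have [A0] : (0 < #|planar_class R n (m n)| * n)%N /\
    \sum_(S <- TT1 | iso_type S == true) gw_weight c l S - eps / 2 <=
      (nballs n true)%:R / (#|planar_class R n (m n)| * n)%N%:R by near: n.
have [_] : (0 < #|planar_class R n (m n)| * n)%N /\
    \sum_(S <- TT2 | iso_type S == false) gw_weight c l S - eps / 2 <=
      (nballs n false)%:R / (#|planar_class R n (m n)| * n)%N%:R by near: n.
have T1 TT : \sum_(S <- TT | iso_type S == true) gw_weight c l S =
    \sum_(S <- TT | iso_type S) gw_weight c l S.
  by apply: eq_bigl => S; rewrite eqb_id.
have T2 TT : \sum_(S <- TT | iso_type S == false) gw_weight c l S =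
    \sum_(S <- TT | ~~ iso_type S) gw_weight c l S.
  by apply: eq_bigl => S; rewrite eqbF_neg.
rewrite T1 T2 prE.
have up : \sum_(S <- TT2 | iso_type S) gw_weight c l S <= p.
  by rewrite -lee_fin pE; exact: gw_ball_prob_ge.
have tot : (nballs n true)%:R / (#|planar_class R n (m n)| * n)%N%:R +
    (nballs n false)%:R / (#|planar_class R n (m n)| * n)%N%:R = 1 :> R.
  by rewrite -mulrDl -natrD nballs_split divff // pnatr_eq0 -lt0n.
move: s2; rewrite (bigID iso_type) /= => s2 b2 b1.
rewrite ler_norml; apply/andP; split; lra.
Unshelve. all: by end_near.
Qed.
End LocalLimit.

Local Open Scope ring_scope.
Local Open Scope classical_set_scope.

Theorem theorem1p3 (R : realType) (m : nat -> nat) (c : R) :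
  (exists C : R, exists N : nat, forall n : nat, (N <= n)%N ->
     (m n)%:R <= n%:R / 2 + C * (n%:R `^ (2 / 3 : R))) ->
  0 <= c <= 1 ->
  (fun n : nat => 2 * (m n)%:R / n%:R) @ \oo --> c ->
  forall (k : nat) (H : {set {set 'I_k}}) (rH : 'I_k) (l : nat),
    is_graph H ->
    (fun n : nat => (pr_ball R n (m n) l H rH)%:E) @ \oo --> gw_ball_prob c l H rH.
Proof.
move=> _ c01 mc k H rH l _.
rewrite -(fineK (gw_ball_prob_fin c01 mc H rH l)).
apply: cvg_EFin; first by near=> n.
exact: local_limit.
Unshelve. all: by end_near.
Qed.
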